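(* Let $G$ be a very well-covered graph and suppose that $J(G)^{(k)}$ has a linear resolution for some integer $k\geq 1$. Then $J(G)$ has a linear resolution.
   Context: Graphs are finite and simple. Let $G$ be a graph with vertex set $V(G)=\{x_1,\ldots,x_n\}$ and edge set $E(G)$, let $\mathbb{K}$ be a field and $S=\mathbb{K}[x_1,\ldots,x_n]$ (vertices are identified with variables). The cover ideal of $G$ is $J(G)=\bigcap_{\{x_i,x_j\}\in E(G)}(x_i,x_j)\subseteq S$. For an integer $k\geq 0$, the $k$th symbolic power of an ideal $I$ of $S$ is $I^{(k)}=\bigcap_{\mathfrak{p}\in \mathrm{Min}(I)}\ker(S\to (S/I^k)_{\mathfrak{p}})$, where $\mathrm{Min}(I)$ is the set of minimal primes of $I$; for the cover ideal this gives $J(G)^{(k)}=\bigcap_{\{x_i,x_j\}\in E(G)}(x_i,x_j)^k$. A subset of $V(G)$ is independent if there are no edges among its vertices; it is a maximal independent subset if it is maximal under inclusion among independent subsets. A graph $G$ without isolated vertices is very well-covered if $n=|V(G)|$ is even and every maximal independent subset of $G$ has cardinality $n/2$. For a finitely generated graded $S$-module $M$, $\beta_{i,j}(M)$ denote the graded Betti numbers, i.e. the $i$th module of the minimal graded free resolution of $M$ is $\bigoplus_j S(-j)^{\beta_{i,j}(M)}$. A homogeneous ideal $I$ has a linear resolution if for some integer $d$, $\beta_{i,i+t}(I)=0$ for all $i$ and every integer $t\neq d$. *)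

(* Defs.v *)
From HB Require Import structures.
From mathcomp Require Import all_boot all_order all_algebra.
From mathcomp Require Import mpoly.

Set Implicit Arguments.
Unset Strict Implicit.
Unset Printing Implicit Defensive.

Import GRing.Theory.
Local Open Scope ring_scope.

(* Ideals are Prop-valued predicates, since a minimal prime, and hence a
   symbolic power, has no boolean membership test a priori. *)
Section Ideals.
Variable R : comNzRingType.
Implicit Types (I J p A : R -> Prop) (k : nat).

Definition is_ideal I : Prop :=
  [/\ I 0, forall f g, I f -> I g -> I (f + g) & forall a f, I f -> I (a * f)].

Definition prime_ideal p : Prop :=
  [/\ is_ideal p, ~ p 1 & forall f g, p (f * g) -> p f \/ p g].

Definition minimal_prime I p : Prop :=
  [/\ prime_ideal p,
      forall f, I f -> p f
    & forall q, prime_ideal q -> (forall f, I f -> q f) ->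
        (forall f, q f -> p f) -> forall f, p f -> q f].

Definition ideal_gen A : R -> Prop := fun f =>
  exists s : seq (R * R),
    (forall c, c \in s -> A c.2) /\ f = \sum_(c <- s) c.1 * c.2.

(* The 0-th power is the unit ideal: it is generated by the empty product. *)
Definition ideal_pow I k : R -> Prop :=
  ideal_gen (fun f => exists t : k.-tuple R,
    (forall i, I (tnth t i)) /\ f = \prod_(i < k) tnth t i).

(* f is in the kernel of R -> (R / I^k)_p iff some s outside p kills the class
   of f in R / I^k. *)
Definition symbolic_pow I k : R -> Prop := fun f =>
  forall p, minimal_prime I p -> exists s, ~ p s /\ ideal_pow I k (s * f).

End Ideals.

Section Graphs.
Variable n : nat.
Implicit Types (e : rel 'I_n) (A : {set 'I_n}).

Definition simple_graph e : Prop := ssrbool.symmetric e /\ irreflexive e.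

Definition independent e : pred {set 'I_n} := fun A =>
  [forall x in A, forall y in A, ~~ e x y].

Definition very_well_covered e : Prop :=
  [/\ forall x, exists y, e x y,
      ~~ odd n
    & forall A, maxset (independent e) A -> #|A| = n./2].

Definition cover_ideal (K : fieldType) e : {mpoly K[n]} -> Prop := fun f =>
  forall i j, e i j -> ideal_gen (fun g => g = 'X_i \/ g = 'X_j) f.

End Graphs.
Arguments cover_ideal {n} K e f.

Section Resolutions.
Variables (n : nat) (K : fieldType).
Local Notation S := {mpoly K[n]}.

Definition homog_of_degree (t : int) (f : S) : Prop :=
  match t with
  | Posz m => f \is m.-homog
  | Negz _ => f = 0
  end.

Definition irrelevant_ideal : S -> Prop :=
  ideal_gen (fun g => exists i, g = 'X_i).

(* F_i is the free module of row vectors of length [rank i], whose a-th basis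
   vector sits in degree [shift a], so F_i is the direct sum of the
   S(- shift a). Maps act on row vectors by right multiplication:
   [aug] is F_0 -> S and [diff i] is F_{i+1} -> F_i. *)
Record free_complex := FreeComplex {
  rank : nat -> nat;
  shift : forall i, 'I_(rank i) -> int;
  aug : 'cV[S]_(rank 0);
  diff : forall i, 'M[S]_(rank i.+1, rank i)
}.

Definition graded_complex (F : free_complex) : Prop :=
  (forall a, homog_of_degree (shift a) (aug F a 0)) /\
  (forall i a b, homog_of_degree (shift a - shift b) (diff F i a b)).

Definition resolves (I : S -> Prop) (F : free_complex) : Prop :=
  [/\ forall f, I f <-> exists u : 'rV_(rank F 0), u *m aug F = f%:M,
      forall u : 'rV_(rank F 0),
        u *m aug F = 0 <-> exists v, u = v *m diff F 0
    & forall i (u : 'rV_(rank F i.+1)),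
        u *m diff F i = 0 <-> exists v, u = v *m diff F i.+1].

(* Minimality, im (F_{i+1} -> F_i) in m F_i, bears on [diff] only: the target
   of F_0 is the resolved ideal itself. *)
Definition minimal_graded_resolution (I : S -> Prop) (F : free_complex) : Prop :=
  [/\ graded_complex F, resolves I F
    & forall i a b, irrelevant_ideal (diff F i a b)].

Definition betti (F : free_complex) (i : nat) (j : int) : nat :=
  #|[set a : 'I_(rank F i) | shift a == j]|.

(* A minimal graded free resolution is unique up to isomorphism, so [betti F]
   does not depend on F; the existential merely names the resolution. *)
Definition has_linear_resolution (I : S -> Prop) : Prop :=
  exists F, minimal_graded_resolution I F /\
    exists d : int, forall (i : nat) (t : int),
      t != d -> betti F i (i%:Z + t) = 0%N.

End Resolutions.

(* Main.v *)
From HB Require Import structures.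
Require Import Defs.
From mathcomp Require Import all_boot all_order all_algebra.
From mathcomp Require Import mpoly ring zify.

(** A very well-covered graph has a perfect matching (Hall's theorem and the
    bound [independent_card_neighbors]); one vertex of each of its edges can be
    taken in a maximal independent set Y. Write x_t, y_t for the two vertices of
    the pair t, with y_t in Y. Every maximal independent set meets every pair in
    exactly one vertex, so the cover ideal J is generated by the monomials of the
    vertex covers that pick one vertex in each pair, and the relation
    [x_i is adjacent to y_j] on the pairs is reflexive and transitive. The
    argument shows that a linear resolution of a symbolic power forces this
    relation to be antisymmetric, and that antisymmetry gives a linear
    resolution of J.

    Necessity. Suppose that x_i, y_j and x_j, y_i are two edges with i and j
    distinct. The monomials of the k-th symbolic power have exponents of sum at
    least k on every edge. The generators have the least possible degree, k times
    the number of pairs; there the exponents on the pairs add up to exactly k, and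
    the two crossing edges force the exponents of x_i and x_j to agree. Hence
    setting x_i to 0 or x_j to 0 has the same effect on a generator. No monomial
    of a linear form contains both x_i and x_j, so linear syzygies of the
    generators are still syzygies after this substitution in the generators
    alone. If they generate all syzygies, the substitution extends to an S-linear
    map from the ideal to S. Such a map cannot fix one nonzero element and
    annihilate another, but this one fixes the k-th power of a cover without x_i
    and annihilates the k-th power of a cover with x_i
    ([linear_syzygies_obstruction], [pair_le_anti_of_linear_resolution]).

    Sufficiency. Consider the partial choices of one vertex in each pair all of
    whose completions are vertex covers. They are the faces of a cubical complex,
    labelled by the least common multiples of the monomials of their vertices. A
    face and a facet of it differ in one pair, so that the quotient of their
    labels is a variable, and the labelled chain complex is linear. It is
    exact by induction on the pairs, taken in an order that extends the partial
    order above: when the choices are fixed in all the pairs before s, either one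
    of them forces y_s, or y_s can always be replaced by x_s and the complex is a
    mapping cone of complexes with the choice at s fixed ([exact_on_free],
    [exact_on_extends]). *)

Set Implicit Arguments.
Unset Strict Implicit.
Unset Printing Implicit Defensive.

(** * Perfect matchings of very well-covered graphs *)

(** Hall's marriage theorem. In a family with the fewest incidences that still
    satisfies Hall's condition, no set contains two points a and b: if
    deleting either of them from the set broke the condition, submodularity of
    the size of a union would break it before the deletion. *)
Lemma hall_marriage (T U : finType) (F : T -> {set U}) :
  (forall B : {set T}, #|B| <= #|\bigcup_(x in B) F x|) ->
  exists f : T -> U, injective f /\ forall x, f x \in F x.
Proof.
have [k] := ubnP (\sum_x #|F x|); elim: k F => // k IHk F lt_k hallF.
have [/existsP[x /card_gt1P[a [b [Fa Fb ab]]]]|] := boolP [exists x, 1 < #|F x|]; last first.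
  rewrite negb_exists => /forallP le1.
  have F1 x : exists a, F x == [set a].
    have /cards1P[a ->] : #|F x| == 1; last by exists a.
    rewrite eqn_leq leqNgt le1 /=.
    by have := hallF [set x]; rewrite big_set1 cards1.
  have [f Ff] : exists f, forall x, F x = [set f x].
    by exists (fun x => xchoose (F1 x)) => x; apply/eqP/(xchooseP (F1 x)).
  exists f; split=> [x y eq_xy|x]; last by rewrite Ff inE.
  apply: contraTeq isT => xy; have := hallF [set x; y].
  by rewrite cards2 xy bigcup_setU !big_set1 !Ff eq_xy setUid cards1.
pose G c y := if y == x then F x :\ c else F y.
have G_sub c y : G c y \subset F y.
  by rewrite /G; case: eqP => [->|//]; apply: subsetDl.
have G_hall c : c \in F x -> (forall B : {set T}, #|B| <= #|\bigcup_(y in B) G c y|) ->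
    exists f : T -> U, injective f /\ forall x, f x \in F x.
  move=> Fc hallG; have [|f [f_inj Gf]] := IHk (G c) _ hallG; last first.
    by exists f; split=> // y; apply: (subsetP (G_sub c y)).
  have : (\sum_y #|G c y| < \sum_y #|F y|).
    rewrite (bigD1 x) //= [ltnRHS](bigD1 x) //= -addSn leq_add //.
      by rewrite /G eqxx [leqRHS](cardsD1 c) Fc.
    by apply: leq_sum => y _; apply/subset_leq_card.
  by move/leq_trans; apply; rewrite -ltnS.
have G_fail c : ~ (forall B : {set T}, #|B| <= #|\bigcup_(y in B) G c y|) ->
    exists2 C : {set T}, x \notin C &
      (#|(\bigcup_(y in C) F y) :|: (F x :\ c)| <= #|C|).
  have [/forallP hG|/forallPn[B]] :=
      boolP [forall B : {set T}, #|B| <= #|\bigcup_(y in B) G c y|]%N.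
    by case.
  rewrite -ltnNge => ltB _; have Bx : x \in B.
    apply: contraLR ltB => Bx; rewrite -leqNgt (leq_trans (hallF B)) //.
    apply/subset_leq_card/bigcupsP => y By; apply: subset_trans (bigcup_sup y By).
    by rewrite /G; case: eqP By Bx => [-> ->|].
  exists (B :\ x); first by rewrite !inE eqxx.
  rewrite -ltnS -[ltnRHS]add1n; have := cardsD1 x B; rewrite Bx => <-.
  apply: leq_ltn_trans ltB; apply/subset_leq_card; rewrite subUset.
  apply/andP; split; last first.
    by apply: subset_trans (bigcup_sup x Bx); rewrite /G eqxx.
  apply/bigcupsP => y; rewrite !inE => /andP[yx By].
  by apply: subset_trans (bigcup_sup y By); rewrite /G (negbTE yx).
have [/forallP|/forallP nHa] := boolP [forall B : {set T}, #|B| <= #|\bigcup_(y in B) G a y|]%N.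
  exact: G_hall.
have [/forallP|/forallP nHb] := boolP [forall B : {set T}, #|B| <= #|\bigcup_(y in B) G b y|]%N.
  exact: G_hall.
have [C1 xC1 le1] := G_fail a nHa; have [C2 xC2 le2] := G_fail b nHb.
set U1 := _ :|: _ in le1; set U2 := _ :|: _ in le2.
have leU : (#|C1 :|: C2|.+1 <= #|U1 :|: U2|).
  have -> : #|C1 :|: C2|.+1 = #|x |: (C1 :|: C2)|.
    by rewrite cardsU1 !inE negb_or xC1 xC2.
  apply: leq_trans (hallF _) _; apply/subset_leq_card/bigcupsP => y.
  rewrite !inE => /orP[/eqP->|/orP[] Cy].
  - apply/subsetP => c Fc; rewrite !inE Fc !andbT.
    by case: (c =P a) => [->|]; rewrite ?ab ?orbT.
  - by rewrite /U1 -!setUA; apply: subset_trans (subsetUl _ _); apply: bigcup_sup.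
  - rewrite setUC /U2 -!setUA; apply: subset_trans (subsetUl _ _); exact: bigcup_sup.
have leI : (#|C1 :&: C2| <= #|U1 :&: U2|).
  apply: leq_trans (hallF _) _; apply/subset_leq_card/bigcupsP => y.
  rewrite inE => /andP[C1y C2y]; rewrite subsetI; apply/andP; split;
    by apply: subset_trans (subsetUl _ _); apply: bigcup_sup.
have := leq_add leU leI; rewrite addSn !cardsUI ltnNge.
by rewrite leq_add.
Qed.

Section Graph.
Variables (n : nat) (e : rel 'I_n).
Implicit Types (A B : {set 'I_n}) (u v : 'I_n).

Definition neighbors A : {set 'I_n} := [set v | [exists u in A, e u v]].

Lemma neighborsP A v : reflect (exists2 u, u \in A & e u v) (v \in neighbors A).
Proof. by rewrite inE; apply: exists_inP. Qed.

Lemma independentP A :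
  reflect {in A &, forall u v, ~~ e u v} (independent e A).
Proof.
apply: (iffP forall_inP) => [Ai u v Au Av|Ai u Au].
  by have /forall_inP := Ai u Au; apply.
by apply/forall_inP => v; apply: Ai.
Qed.

Lemma independentS A B : A \subset B -> independent e B -> independent e A.
Proof.
move=> /subsetP AB /independentP Bi; apply/independentP => u v /AB Bu /AB; exact: Bi.
Qed.

Hypothesis e_simple : simple_graph e.

Lemma independentU A B : independent e A -> independent e B ->
  [disjoint B & neighbors A] -> independent e (A :|: B).
Proof.
have [e_sym _] := e_simple.
move=> /independentP Ai /independentP Bi /pred0P AB; apply/independentP => u v.
have nAB a b : a \in A -> b \in B -> ~~ e a b.
  move=> Aa Bb; apply/negP => eab; have := AB b; rewrite /= Bb.
  by move/negP; apply; apply/neighborsP; exists a.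
rewrite !inE => /orP[Au|Bu] /orP[Av|Bv]; [exact: Ai|exact: nAB| |exact: Bi].
by rewrite e_sym; apply: nAB.
Qed.

Lemma independent1 u : independent e [set u].
Proof.
by apply/independentP => a b /[!inE] /eqP-> /eqP->; rewrite (proj2 e_simple).
Qed.

Hypothesis e_vwc : very_well_covered e.

Lemma independent_card_maxset A B : independent e A -> maxset (independent e) B ->
  (#|A| <= #|B|).
Proof.
have [_ _ card_max] := e_vwc.
move=> Ai Bmax; have [A' A'max AA'] := maxset_exists Ai.
by rewrite (card_max _ Bmax) -(card_max _ A'max) subset_leq_card.
Qed.

(** Let T be a maximal independent subset of the neighbourhood of A. Exchanging
    T for the part of A adjacent to T inside a maximal independent set shows
    that this part has at most #|T| elements; the rest of A has no neighbour
    in T, and induction applies to it. *)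
Lemma independent_card_neighbors A :
  independent e A -> (#|A| <= #|neighbors A|).
Proof.
have [no_isolated _ _] := e_vwc; have [e_sym _] := e_simple.
have [k] := ubnP #|A|; elim: k A => // k IHk A lt_k Ai.
have [->|[a Aa]] := set_0Vmem A; first by rewrite cards0.
have [v eav] := no_isolated a.
have NAv : v \in neighbors A by apply/neighborsP; exists a.
have [|T Tmax vT] := @maxset_exists _ [pred B | independent e B & B \subset neighbors A] [set v].
  by rewrite inE independent1 sub1set.
have {vT} Tv : v \in T by apply: (subsetP vT); rewrite inE.
have [/andP[Ti TNA] Tmax'] := maxsetP Tmax.
pose A' := A :\: neighbors T.
have A'N : [disjoint A' & neighbors T].
  by rewrite disjoint_sym disjoints_subset setCD subsetUr.
have A'i : independent e A' by apply: independentS Ai; apply: subsetDl.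
have [I Imax TA'I] := maxset_exists (independentU Ti A'i A'N).
have [/independentP Ii _] := maxsetP Imax.
have TI : T \subset I by apply: subset_trans TA'I; apply: subsetUl.
pose R := I :\: (A :|: neighbors A).
have ARi : independent e (A :|: R).
  apply: independentU => //; first by apply: independentS (proj1 (maxsetP Imax)); apply: subsetDl.
  by rewrite disjoint_sym disjoints_subset setCD setUA subsetUr.
have le_I : (#|I| <= #|R| + (#|T| + #|A'|)).
  apply: leq_trans (leq_trans (leq_card_setU R (T :|: A')) _); last first.
    by rewrite leq_add2l leq_card_setU.
  apply/subset_leq_card/subsetP => b Ib.
  have [Ab|nAb] := boolP (b \in A).
    rewrite 2!in_setU [b \in A']in_setD Ab andbT; apply/or3P/Or33/negP => /neighborsP[t Tt etb].
    by have := Ii t b (subsetP TI t Tt) Ib; rewrite etb.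
  have [NAb|nNAb] := boolP (b \in neighbors A); last first.
    by rewrite 2!in_setU in_setD in_setU (negbTE nAb) (negbTE nNAb) Ib.
  rewrite 2!in_setU; apply/or3P/Or32.
  suff <- : b |: T = T by rewrite setU11.
  apply: Tmax'; last exact: subsetUr.
  rewrite /= subUset sub1set NAb TNA !andbT setUC; apply: independentU => //;
    first exact: independent1.
  apply/pred0P => c; rewrite /= inE; case: eqP => //= ->; apply/negP => /neighborsP[t Tt etb].
  by have := Ii t b (subsetP TI t Tt) Ib; rewrite etb.
have le_A : (#|A| <= #|T| + #|A'|).
  rewrite -(leq_add2l #|R|) (leq_trans _ le_I) //.
  apply: leq_trans (independent_card_maxset ARi Imax).
  rewrite cardsU [A :&: R](_ : _ = set0) ?cards0 ?subn0 1?addnC //.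
  by apply/setP => b; rewrite !inE; case: (b \in A).
apply: leq_trans le_A _.
have lt_A' : (#|A'| < k).
  rewrite -ltnS; apply: leq_trans lt_k; rewrite ltnS; apply/proper_card/properP.
  split; first exact: subsetDl.
  exists a => //; rewrite !inE negb_and negbK; apply/orP; left; apply/exists_inP.
  by exists v => //; rewrite e_sym.
apply: leq_trans (leq_add (leqnn _) (IHk _ lt_A' A'i)) _.
rewrite -[leqRHS](cardsID T) (setIidPr TNA) leq_add2l subset_leq_card //.
apply/subsetP => b /neighborsP[c]; rewrite in_setD => /andP[NTc Ac] ecb.
rewrite in_setD; apply/andP; split; last by apply/neighborsP; exists c.
by apply: contraNN NTc => Tb; apply/neighborsP; exists b; rewrite // e_sym.
Qed.

End Graph.

(** A perfect matching with oriented edges: bijectivity of [vt] makes the pairs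
    disjoint and exhaustive, and the boolean tells the two vertices x_t ([true])
    and y_t ([false]) of a pair apart. *)
Record pairing n (e : rel 'I_n) (T : finType) (vt : T * bool -> 'I_n) := Pairing {
  pairing_bij : bijective vt;
  pairing_edge : forall t, e (vt (t, true)) (vt (t, false));
  pairing_indep : forall s t, ~~ e (vt (s, false)) (vt (t, false))
}.

Definition transversal_cover n (e : rel 'I_n) (T : finType) (vt : T * bool -> 'I_n)
    (c : T -> bool) : Prop :=
  forall p q, e (vt p) (vt q) -> c p.1 = p.2 \/ c q.1 = q.2.

Section Matching.
Variables (n : nat) (e : rel 'I_n).
Hypotheses (e_simple : simple_graph e) (e_vwc : very_well_covered e).

Lemma pairing_exists : exists (T : finType) (vt : T * bool -> 'I_n), pairing e vt.
Proof.
have [no_isolated n_even card_max] := e_vwc; have [e_sym e_irr] := e_simple.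
have [|Y Ymax _] := @maxset_exists _ (independent e) set0.
  by apply/independentP => u v; rewrite inE.
have [Yi _] := maxsetP Ymax.
pose T : finType := {y | y \in Y}.
have [B|f [f_inj ef]] := @hall_marriage T _ (fun y => neighbors e [set val y]).
  have Bi : independent e (val @: B).
    by apply: independentS Yi; apply/subsetP => _ /imsetP[y _ ->]; apply: valP.
  rewrite -(card_imset _ val_inj).
  apply: leq_trans (independent_card_neighbors e_simple e_vwc Bi) _.
  apply/subset_leq_card/subsetP => v /neighborsP[_ /imsetP[y By ->] eyv].
  by apply/bigcupP; exists y => //; apply/neighborsP; exists (val y); rewrite ?inE.
have {}ef (y : T) : e (val y) (f y).
  by have /neighborsP[u] := ef y; rewrite inE => /eqP->.
have fY (y : T) : f y \notin Y.
  apply/negP => Yfy; have /independentP/(_ (val y) (f y) (valP y) Yfy) := Yi.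
  by rewrite ef.
exists T, (fun p => if p.2 then f p.1 else val p.1); split=> [|t|s t].
- apply: inj_card_bij => [[s []] [t []] /=|].
  + by move/f_inj->.
  + by move=> fst; have := fY s; rewrite fst (valP t).
  + by move=> fst; have := fY t; rewrite -fst (valP s).
  + by move/val_inj->.
  rewrite card_ord card_prod card_bool card_sig -[n in (n <= _)]odd_double_half.
  rewrite (negbTE n_even) add0n -(card_max Y Ymax) -muln2 leq_mul2r /=.
  by apply/subset_leq_card/subsetP.
- by rewrite e_sym ef.
- exact: (independentP _ _ Yi) (valP s) (valP t).
Qed.

Variables (T : finType) (vt : T * bool -> 'I_n).
Hypothesis vt_pairing : pairing e vt.

(** A maximal independent set has as many vertices as there are pairs, and at
    most one in each pair, so that its complement picks one vertex in each. *)
Lemma transversal_cover_avoiding A : independent e A ->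
  exists2 c : T -> bool, transversal_cover e vt c & forall t, vt (t, c t) \notin A.
Proof.
have [_ n_even card_max] := e_vwc; have [e_sym _] := e_simple.
case: vt_pairing => vt_bij vt_edge _ Ai.
have [M Mmax AM] := maxset_exists Ai; have [/independentP Mi _] := maxsetP Mmax.
have once t b b' : vt (t, b) \in M -> vt (t, b') \in M -> b = b'.
  case: b b' => [] [] // M1 M2; [have := Mi _ _ M1 M2|have := Mi _ _ M2 M1];
  by rewrite vt_edge.
pose N := vt @^-1: M.
have cardN : #|N| = #|T|.
  rewrite on_card_preimset; last exact: onW_bij.
  rewrite card_max //; have /bij_eq_card := vt_bij; rewrite card_ord card_prod card_bool => <-.
  by rewrite muln2 doubleK.
have N_onto : fst @: N = setT.
  apply/eqP; rewrite eqEcard subsetT cardsT card_in_imset ?cardN //=.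
  by move=> [t b] [s b']; rewrite !inE /= => Mt Ms ts; subst s; congr (_, _); apply: once Mt Ms.
have some_in t : exists b, vt (t, b) \in M.
  have : t \in fst @: N by rewrite N_onto inE.
  by case/imsetP=> [[s b]]; rewrite inE /= => Mb ->; exists b.
pose c t := vt (t, true) \notin M.
have Mc t b : (vt (t, b) \in M) = (c t != b).
  rewrite /c; case: b; first by case: (_ \in M).
  have [b Mb] := some_in t; have [Mt|Mt] /= := boolP (vt (t, true) \in M).
    by apply/negP => Mf; have := once _ _ _ Mt Mf.
  by case: b Mb => [|->] //; rewrite (negbTE Mt).
exists c => [[s b] [t b'] /= est|t]; last by apply/negP => /(subsetP AM); rewrite Mc eqxx.
case: (c s =P b) => [->|/eqP]; [by left|rewrite -Mc => Ms].
case: (c t =P b') => [->|/eqP]; [by right|rewrite -Mc => Mt].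
by have := Mi _ _ Ms Mt; rewrite est.
Qed.

(** A cover avoiding both ends of the missing edge cannot cover both given
    edges with a single vertex of the middle pair. *)
Lemma pairing_edge_trans i j k :
  e (vt (i, true)) (vt (j, false)) -> e (vt (j, true)) (vt (k, false)) ->
  e (vt (i, true)) (vt (k, false)).
Proof.
have [e_sym e_irr] := e_simple; move=> eij ejk; apply/negPn/negP => nik.
have [|c c_cover cA] := @transversal_cover_avoiding [set vt (i, true); vt (k, false)].
  apply/independentP => u v /[!inE] /orP[]/eqP-> /orP[]/eqP->;
    by rewrite ?e_irr // 1?e_sym ?nik.
have := cA i; have := cA k; rewrite !inE !(bij_eq (pairing_bij vt_pairing)) !xpair_eqE.
case: (c_cover _ _ eij) (c_cover _ _ ejk) => /= [->|cj] [|].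
all: rewrite ?eqxx //= ?cj // => ->; by rewrite eqxx ?orbT.
Qed.

End Matching.

Import GRing.Theory.
Local Open Scope ring_scope.

(** * Ideals and monomials *)

Lemma ideal_gen_is_ideal (R : comNzRingType) (A : R -> Prop) :
  is_ideal (ideal_gen A).
Proof.
split=> [|f g [s [sA ->]] [t [tA ->]]|a f [s [sA ->]]].
- by exists [::]; rewrite big_nil.
- exists (s ++ t); rewrite big_cat; split=> // c.
  by rewrite mem_cat => /orP[/sA|/tA].
- exists [seq (a * c.1, c.2) | c <- s]; split=> [_ /mapP[c /sA Ac ->] //|].
  by rewrite big_map mulr_sumr; apply: eq_bigr => c _; rewrite mulrA.
Qed.

Lemma mem_ideal_gen (R : comNzRingType) (A : R -> Prop) f :
  A f -> ideal_gen A f.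
Proof.
by move=> Af; exists [:: (1, f)]; rewrite big_seq1 mul1r; split=> // c /[!inE] /eqP->.
Qed.

Lemma ideal_gen_sub (R : comNzRingType) (A I : R -> Prop) :
  is_ideal I -> (forall f, A f -> I f) -> forall f, ideal_gen A f -> I f.
Proof.
move=> [I0 ID IM] AI f [s [sA ->]]; rewrite big_seq.
by elim/big_ind: _ => // c /sA /AI; apply: IM.
Qed.

Section Monomials.
Variables (n : nat) (K : fieldType).
Local Notation S := {mpoly K[n]}.
Implicit Types (f g : S) (m : 'X_{1..n}) (a i j : 'I_n).

Lemma ideal_sum_monomials (I : S -> Prop) f :
  is_ideal I -> (forall m, m \in msupp f -> I 'X_[m]) -> I f.
Proof.
move=> [I0 ID IM] If; rewrite [f]mpolyE big_seq.
by elim/big_ind: _ => // m /If Im; rewrite -mul_mpolyC; apply: IM.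
Qed.

Lemma monomial_divides m m' : (forall i, (m i <= m' i)%N) ->
  'X_[m'] = 'X_[m' - m] * 'X_[m] :> S.
Proof. by move=> le_mm'; rewrite -mpolyXD submK //; apply/mnm_lepP. Qed.

Lemma variable_divides i m : (0 < m i)%N -> 'X_[m] = 'X_[m - U_(i)] * 'X_i :> S.
Proof.
by move=> mi; apply: monomial_divides => j; rewrite mnm1E; case: eqP => // <-.
Qed.

Lemma is_ideal_monomials (P : 'X_{1..n} -> Prop) :
  (forall m m', P m -> P (m' + m)%MM) ->
  is_ideal (fun f => forall m, m \in msupp f -> P m).
Proof.
move=> Padd; split=> [m|f g Pf Pg m /msuppD_le|a f Pf m /msuppM_le].
- by rewrite msupp0.
- by rewrite mem_cat => /orP[/Pf|/Pg].
- by case/allpairsP=> [[m1 m2]] [_ /= /Pf Pm2 ->]; apply: Padd.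
Qed.

(** Setting a variable to 0 is used in both halves of the proof: it tests
    whether syzygies are linear, and it separates the two ends of a mapping
    cone. *)
Definition kill a : S -> S := mmap (@mpolyC n K) (fun i => if i == a then 0 else 'X_i).

HB.instance Definition _ a := GRing.RMorphism.copy (kill a)
  (mmap (@mpolyC n K) (fun i => if i == a then 0 else 'X_i)).

Lemma killX a m : kill a 'X_[m] = if m a == 0%N then 'X_[m] else 0.
Proof.
rewrite /kill mmapX /mmap1; case: eqP => [ma0|/eqP].
  rewrite mpolyXE_id; apply: eq_bigr => i _.
  by case: eqP => // ->; rewrite ma0 !expr0.
by move=> ma; rewrite (bigD1 a) //= eqxx expr0n (negbTE ma) mul0r.
Qed.

Lemma kill_coef a f m : (kill a f)@_m = if m a == 0%N then f@_m else 0.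
Proof.
rewrite {1}[f]mpolyE (raddf_sum (kill a)) (raddf_sum (mcoeff m)) /=.
transitivity (\sum_(m' <- msupp f) (if m a == 0%N then (f@_m' *: 'X_[m'])@_m else 0)).
  apply: eq_bigr => m' _; rewrite -mul_mpolyC rmorphM /= {1}/kill mmapC killX.
  rewrite mul_mpolyC mcoeffZ mcoeffX; case: (m' =P m) => [->|].
    by case: eqP => _; rewrite !mcoeffCM ?mcoeffX ?eqxx ?mcoeff0 // mulr0.
  by move=> /eqP ne; case: (m' a == _);
    rewrite mcoeffCM ?mcoeffX ?(negbTE ne) ?mcoeff0 mulr0; case: ifP.
case: ifP => _; last by rewrite big1.
by rewrite [in RHS](mpolyE f) raddf_sum.
Qed.

Lemma kill_idem a f : kill a (kill a f) = kill a f.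
Proof. by apply/mpolyP => m; rewrite !kill_coef; case: (m a == 0%N). Qed.

Lemma kill_var a i : kill a 'X_i = if i == a then 0 else 'X_i.
Proof. by rewrite killX mnm1E; case: (i == a). Qed.

Lemma divides_of_kill a f : kill a f = 0 -> exists g, f = 'X_a * g.
Proof.
move=> /mpolyP f0; apply: (@ideal_sum_monomials (fun h => exists g, h = 'X_a * g)).
  split=> [|_ _ [g ->] [g' ->]|b _ [g ->]].
  - by exists 0; rewrite mulr0.
  - by exists (g + g'); rewrite mulrDr.
  - by exists (b * g); rewrite mulrCA.
move=> m mf; exists 'X_[m - U_(a)]; rewrite mulrC; apply: variable_divides.
rewrite lt0n; apply: contraTneq mf => ma.
by rewrite mcoeff_msupp negbK -(mcoeff0 _ m) -f0 kill_coef ma eqxx.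
Qed.

Lemma kill_split a f : exists g, f = kill a f + 'X_a * g.
Proof.
have [|g eg] := @divides_of_kill a (f - kill a f).
  rewrite raddfB /=; apply/eqP; rewrite subr_eq0; apply/eqP/mpolyP => m.
  by rewrite !kill_coef; case: ifP.
by exists g; rewrite -eg addrC subrK.
Qed.

(** No monomial of a linear form is divisible by two variables. *)
Lemma kill_linear_form a b f : a != b -> f \is 1.-homog ->
  f = kill a f + kill b f - kill a (kill b f).
Proof.
move=> ab /dhomogP f1; apply/mpolyP => m.
rewrite mcoeffB mcoeffD !kill_coef; have [fm|/memN_msupp_eq0->] := boolP (m \in msupp f);
  last by rewrite !if_same addr0 subr0.
have /eqP := f1 m fm; rewrite mdeg_eq1 => /existsP[i /eqP->]; rewrite !mnm1E.
case: (eqVneq i a) => [->|]; first by rewrite (negbTE ab) /= add0r subr0.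
by case: (i == b); rewrite /= ?addr0 ?subr0 ?addrK.
Qed.

End Monomials.

(** * Weights and symbolic powers of the cover ideal *)

Lemma coefM_lowest (R : comNzRingType) (p q : {poly R}) c :
  (forall b, (b < c)%N -> q`_b = 0) -> (p * q)`_c = p`_0 * q`_c.
Proof.
move=> q0; rewrite coefM big_ord_recl subn0 big1 ?addr0 // => i _.
by rewrite q0 ?mulr0 // /lift /= /bump /= add1n ltn_subrL /= (leq_ltn_trans _ (ltn_ord i)).
Qed.

Section Weights.
Variables (n : nat) (K : fieldType) (w : 'I_n -> nat).
Local Notation S := {mpoly K[n]}.
Implicit Types (f g : S) (m : 'X_{1..n}).

Definition weight m : nat := \sum_i m i * w i.

Lemma weightD m m' : weight (m + m') = (weight m + weight m')%N.
Proof.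
by rewrite -big_split; apply: eq_bigr => i _; rewrite mnmDE mulnDl.
Qed.

(** Substituting [X_i t^(w i)] for [X_i] turns the weight into the exponent
    of t, so that leading terms for the weight can be multiplied in a
    polynomial ring over a domain. *)
Definition weight_expand : S -> {poly S} :=
  mmap (polyC \o @mpolyC n K) (fun i => ('X_i)%:P * 'X^(w i)).

HB.instance Definition _ := GRing.RMorphism.copy weight_expand
  (mmap (polyC \o @mpolyC n K) (fun i => ('X_i)%:P * 'X^(w i))).

Lemma weight_expandX m : weight_expand 'X_[m] = ('X_[m])%:P * 'X^(weight m).
Proof.
rewrite /weight_expand mmapX /mmap1 (eq_bigr (fun i =>
  ('X_i ^+ m i)%:P * 'X^(m i * w i))) => [|i _]; last first.
  by rewrite exprMn rmorphXn -exprM mulnC.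
by rewrite big_split /= -(rmorph_prod polyC) -mpolyXE_id prodrXr.
Qed.

Lemma weight_expand_coef f c m :
  ((weight_expand f)`_c)@_m = if weight m == c then f@_m else 0.
Proof.
rewrite {1}[f]mpolyE (raddf_sum weight_expand) coef_sum (raddf_sum (mcoeff m)) /=.
transitivity (\sum_(m' <- msupp f)
    (if weight m == c then (f@_m' *: 'X_[m'])@_m else 0)).
  apply: eq_bigr => m' _; rewrite -mul_mpolyC rmorphM /= {1}/weight_expand mmapC.
  rewrite weight_expandX /= mulrA -rmorphM coefCM coefXn mulr_natr mcoeffMn.
  rewrite mul_mpolyC mcoeffZ mcoeffX.
  have [->|_] := eqVneq m' m; last by rewrite !mulr0 mul0rn if_same.
  by rewrite eq_sym; case: eqP.
case: ifP => _; last by rewrite big1.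
by rewrite [in RHS](mpolyE f) raddf_sum.
Qed.

(** The weight-c component of [s * f], for c the least weight in f, is the
    product of the weight-0 component of s and the weight-c component of f. *)
Lemma weight_ge_cancel k s f :
  (exists2 m, m \in msupp s & weight m = 0%N) ->
  (forall m, m \in msupp (s * f) -> (k <= weight m)%N) ->
  forall m, m \in msupp f -> (k <= weight m)%N.
Proof.
move=> [m0 sm0 w0] ge_k m fm; rewrite leqNgt; apply/negP => lt_mk.
have /ex_minnP[c] : exists c, has (fun m' => weight m' == c) (msupp f).
  by exists (weight m); apply/hasP; exists m.
move=> /hasP[m1 fm1 /eqP w1] min_c.
have lt_ck : (c < k)%N.
  by apply: leq_ltn_trans lt_mk; apply: min_c; apply/hasP; exists m.
have nz_s : (weight_expand s)`_0 != 0.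
  apply/eqP => /(congr1 (mcoeff m0)); rewrite weight_expand_coef w0 eqxx mcoeff0.
  by apply/eqP; rewrite -mcoeff_msupp.
have nz_f : (weight_expand f)`_c != 0.
  apply/eqP => /(congr1 (mcoeff m1)); rewrite weight_expand_coef w1 eqxx mcoeff0.
  by apply/eqP; rewrite -mcoeff_msupp.
have /negP[] := mulf_neq0 nz_s nz_f.
have -> : (weight_expand s)`_0 * (weight_expand f)`_c = (weight_expand (s * f))`_c.
  rewrite rmorphM; apply/esym/coefM_lowest => b lt_bc.
  apply/mpolyP => m'; rewrite weight_expand_coef mcoeff0.
  case: eqP => // wm'; apply: memN_msupp_eq0; apply/negP => fm'.
  have := min_c b; rewrite leqNgt lt_bc => /(_ _)/negP; apply=> //.
  by apply/hasP; exists m' => //; rewrite wm'.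
apply/eqP/mpolyP => m'; rewrite weight_expand_coef mcoeff0.
case: eqP => // wm'; apply: memN_msupp_eq0; apply/negP => /ge_k.
by rewrite wm' leqNgt lt_ck.
Qed.

Lemma weight_ge_ideal k :
  is_ideal (fun f => forall m, m \in msupp f -> (k <= weight m)%N).
Proof.
apply: (@is_ideal_monomials n K (fun m => (k <= weight m)%N)) => m m' le_k.
by rewrite weightD (leq_trans le_k) ?leq_addl.
Qed.

Lemma weight_gt0_prime :
  prime_ideal (fun f => forall m, m \in msupp f -> (0 < weight m)%N).
Proof.
split=> [||f g fg]; first exact: weight_ge_ideal.
  move=> /(_ 0%MM); rewrite msupp1 inE eqxx => /(_ isT).
  by rewrite /weight big1 // => i _; rewrite mnm0E.
have [/allP|/allPn[m fm]] := boolP (all (fun m => 0 < weight m)%N (msupp f)); first by left.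
rewrite lt0n negbK => /eqP wm; right; apply: weight_ge_cancel fg.
by exists m.
Qed.

Lemma ideal_pow_weight (I : S -> Prop) k :
  (forall f, I f -> forall m, m \in msupp f -> (0 < weight m)%N) ->
  forall f, ideal_pow I k f -> forall m, m \in msupp f -> (k <= weight m)%N.
Proof.
move=> I_gt0; apply: ideal_gen_sub => [|_ [t [It ->]]]; first exact: weight_ge_ideal.
have prod_ge (r : seq 'I_k) m :
    m \in msupp (\prod_(i <- r) tnth t i) -> (size r <= weight m)%N.
  elim: r m => [|i r IHr] //= m.
  rewrite big_cons => /msuppM_le/allpairsP[[m1 m2] [/= /(I_gt0 _ (It i)) gt0 /IHr ge ->]].
  by rewrite weightD -add1n leq_add.
move=> m /prod_ge; suff -> : size (index_enum 'I_k) = k by [].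
by rewrite -[RHS]card_ord cardE enumT.
Qed.

End Weights.

Section SymbolicPower.
Variables (n : nat) (K : fieldType) (e : rel 'I_n).
Hypothesis e_simple : simple_graph e.
Local Notation S := {mpoly K[n]}.
Local Notation J := (cover_ideal K e).
Implicit Types (f g : S) (m : 'X_{1..n}) (i j : 'I_n).

Lemma edge_weight i j m : e i j ->
  weight (fun l => (l == i) || (l == j)) m = (m i + m j)%N.
Proof.
move=> eij; have ij : j != i.
  by apply: contraTneq eij => ->; rewrite (proj2 e_simple).
rewrite /weight (bigD1 i) //= eqxx muln1 (bigD1 j) //= eqxx orbT muln1 addnA.
rewrite big1 ?addn0 // => l /andP[/negbTE-> /negbTE->].
by rewrite muln0.
Qed.

Lemma mem_cover_ideal f :
  J f <-> forall i j, e i j -> forall m, m \in msupp f -> (0 < m i + m j)%N.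
Proof.
split=> [Jf i j eij|f_gt0 i j eij].
  apply: (@ideal_gen_sub _ _ (fun g => forall m, m \in msupp g -> (0 < m i + m j)%N)
            _ _ f (Jf i j eij)).
    apply: (@is_ideal_monomials n K (fun m => (0 < m i + m j)%N)) => m m' lt.
    by rewrite !mnmDE addnACA (leq_trans lt) ?leq_addl.
  by move=> g [] -> m; rewrite msuppX inE => /eqP->; rewrite !mnm1E eqxx ?addn1.
apply: ideal_sum_monomials => [|m /(f_gt0 _ _ eij)]; first exact: ideal_gen_is_ideal.
have [_ _ IM] := ideal_gen_is_ideal (fun g : S => g = 'X_i \/ g = 'X_j).
rewrite addn_gt0 => /orP[] /(variable_divides K)->; apply: IM; apply: mem_ideal_gen;
  by [left|right].
Qed.

(** A prime q below the ideal of the edge contains the product of [X_i] and of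
    all the variables off the edge, which lies in J, but not the second factor;
    so q contains [X_i], and likewise [X_j]. *)
Lemma edge_minimal_prime i j : e i j ->
  minimal_prime J (fun f => forall m, m \in msupp f -> (0 < m i + m j)%N).
Proof.
move=> eij; split=> [|f Jf|q [q_ideal q1 q_prime] Jq qp f f_gt0].
- have [[p0 pD pM] p1 p_prime] := weight_gt0_prime K (fun l => (l == i) || (l == j)).
  have E g : (forall m, m \in msupp g -> (0 < m i + m j)%N) <->
     (forall m, m \in msupp g -> (0 < weight (fun l => (l == i) || (l == j)) m)%N).
    by split=> g0 m /g0; rewrite edge_weight.
  split=> [||f g /E/p_prime[]/E]; [|by move=> /E/p1|by left|by right].
  split; first exact/E.
    by move=> f g /E pf /E pg; apply/E; apply: pD.
  by move=> a f /E pf; apply/E; apply: pM.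
- by move/mem_cover_ideal: Jf; apply.
pose m0 : 'X_{1..n} := [multinom ((l != i) && (l != j) : nat) | l < n].
have qX l : (l == i) || (l == j) -> q 'X_l.
  (* every vertex except one end of the edge: a vertex cover *)
  move=> lij; have : J ('X_l * 'X_[m0]).
    rewrite -mpolyXD; apply/mem_cover_ideal => a b eab m; rewrite msuppX inE => /eqP->.
    have ab : a != b by apply: contraTneq eab => ->; rewrite (proj2 e_simple).
    rewrite !mnmDE !mnm1E !mnmE addn_gt0 !addn_gt0 !lt0b.
    rewrite -!negb_or; have [aij|] := boolP ((a == i) || (a == j)); last by rewrite orbT.
    have [bij|] := boolP ((b == i) || (b == j)); last by rewrite !orbT.
    rewrite !orbF; case/orP: lij => /eqP->; case/orP: aij ab => /eqP->;
      case/orP: bij => /eqP->; by rewrite ?eqxx ?orbT.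
  move=> /Jq/q_prime[//|/qp/(_ m0)]; rewrite msuppX inE eqxx => /(_ isT).
  by rewrite !mnmE !eqxx andbF.
case: (q_ideal) => _ _ qM; apply: ideal_sum_monomials => // m /f_gt0.
rewrite addn_gt0 => /orP[] /(variable_divides K)->; apply/qM/qX; rewrite eqxx ?orbT //.
Qed.

(** At the minimal prime generated by the ends of an edge, the k-th power of
    the cover ideal has weight at least k, and weights survive cancellation of
    an element outside the prime. *)
Lemma symbolic_pow_monomials k f : symbolic_pow J k f ->
  forall i j, e i j -> forall m, m \in msupp f -> (k <= m i + m j)%N.
Proof.
move=> Jf i j eij m fm; have [s [ps Jsf]] := Jf _ (edge_minimal_prime eij).
rewrite -edge_weight //; apply: weight_ge_cancel fm; last first.
  move=> m'; apply: ideal_pow_weight Jsf m' => g Jg m' gm'.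
  by rewrite edge_weight //; move/mem_cover_ideal: Jg; apply.
have [/allP s_gt0|/allPn[m' sm']] := boolP (all (fun m => 0 < m i + m j)%N (msupp s)).
  by case: ps.
by rewrite -edge_weight // lt0n negbK => /eqP; exists m'.
Qed.

Lemma expr_symbolic_pow k f : J f -> symbolic_pow J k (f ^+ k).
Proof.
move=> Jf p [[_ p1 _] _ _]; exists 1; split=> //; rewrite mul1r.
apply: mem_ideal_gen; exists [tuple of nseq k f].
split=> [i|]; first by rewrite tnth_nseq.
by rewrite (eq_bigr (fun=> f)) ?prodr_const ?card_ord // => i _; rewrite tnth_nseq.
Qed.

End SymbolicPower.

(** * The cubical complex of a perfect matching *)

(** The terms are cancelled in pairs, and the vanishing diagonal is assumed, so
    that the argument is valid in characteristic 2. *)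
Lemma sum_antisymmetric (V : zmodType) (T : finType) (G : T -> T -> V) :
  (forall t, G t t = 0) -> (forall s t, G s t + G t s = 0) ->
  \sum_s \sum_t G s t = 0.
Proof.
move=> G0 GN; pose lt (s t : T) := (enum_rank s < enum_rank t)%N.
have split_sum s : \sum_t G s t = \sum_(t | lt s t) G s t + \sum_(t | lt t s) G s t.
  rewrite (bigID (lt s)) /=; congr (_ + _).
  rewrite (bigD1 s) ?ltnn //= ?G0 ?add0r; last by rewrite /lt ltnn.
  apply: eq_bigl => t; rewrite /lt -leqNgt ltn_neqAle andbC.
  by rewrite (inj_eq val_inj) (inj_eq enum_rank_inj).
rewrite (eq_bigr _ (fun s _ => split_sum s)) big_split /=.
rewrite [X in _ + X](exchange_big_dep predT) //= -big_split big1 // => s _.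
by rewrite -big_split big1 // => t _; apply: GN.
Qed.

Section Cubes.
Variable T : finType.
Implicit Types (s t : T) (c : {ffun T -> option bool}).

(** A face of the cube of all choices in the pairs indexed by T: the value
    [None] stands for a pair where both choices are allowed. *)
Definition cube := {ffun T -> option bool}.

Definition upd c t (o : option bool) : cube := [ffun s => if s == t then o else c s].

Lemma updE c t o s : upd c t o s = if s == t then o else c s.
Proof. exact: ffunE. Qed.

Lemma upd_same c t o : upd c t o t = o. Proof. by rewrite updE eqxx. Qed.

Lemma upd_upd c t o o' : upd (upd c t o) t o' = upd c t o'.
Proof. by apply/ffunP => s; rewrite !updE; case: (s == t). Qed.

Lemma upd_id c t : upd c t (c t) = c.
Proof. by apply/ffunP => s; rewrite !updE; case: eqP => [->|]. Qed.

Lemma upd_comm c s t o o' : s != t -> upd (upd c s o) t o' = upd (upd c t o') s o.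
Proof.
move=> st; apply/ffunP => r; rewrite !updE.
by case: (r =P t) => [->|//]; rewrite eq_sym (negbTE st).
Qed.

Definition stars c : {set T} := [set t | c t == None].

Lemma stars_upd c t : stars (upd c t None) = t |: stars c.
Proof. by apply/setP => s; rewrite !inE updE; case: (s == t). Qed.

Definition starless c := stars c == set0.

Lemma starlessP c : reflect (forall t, c t != None) (starless c).
Proof.
apply: (iffP eqP) => [c0 t|c_star].
  by apply/negP => ct; have := in_set0 t; rewrite -c0 inE ct.
by apply/setP => t; rewrite !inE (negbTE (c_star t)).
Qed.

(** The pairs are ordered by [enum_rank] only to orient the cubes; this order
    is unrelated to the adjacencies of the graph. *)
Definition star_sign t c : nat := #|[set s in stars c | (enum_rank s < enum_rank t)%N]|.

Lemma star_sign_upd s t c : c s != None ->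
  star_sign t (upd c s None) = (star_sign t c + (enum_rank s < enum_rank t)%N)%N.
Proof.
move=> cs; rewrite /star_sign stars_upd; have [lt_st|ge_st] := boolP (_ < _)%N.
  rewrite (_ : [set _ in _ | _] = s |: [set r in stars c | (enum_rank r < enum_rank t)%N]).
    by rewrite cardsU1 !inE (negbTE cs) addnC.
  by apply/setP => r; rewrite !inE; case: eqP => [->|].
rewrite addn0; apply: eq_card => r; rewrite !inE.
by case: eqP => // ->; rewrite (negbTE ge_st) !andbF.
Qed.

Lemma star_sign_self t c o : star_sign t (upd c t o) = star_sign t c.
Proof.
apply: eq_card => s; rewrite !inE updE.
by case: (s =P t) => // ->; rewrite ltnn !andbF.
Qed.

End Cubes.

Section Complex.
Variables (n : nat) (K : fieldType) (T : finType) (vt : T * bool -> 'I_n).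
Local Notation S := {mpoly K[n]}.
Local Notation cube := (cube T).
Local Notation chain := {ffun cube -> S}.
Implicit Types (s t : T) (c : cube) (z w : chain).

Definition pair_var t b : S := 'X_(vt (t, b)).

Definition face_var t (o : option bool) : S :=
  match o with
  | None => 0
  | Some true => - pair_var t false
  | Some false => pair_var t true
  end.

Definition face_coef t c : S := (-1) ^+ star_sign t c * face_var t (c t).

(** A cell stands for the least common multiple of the labels of its vertices.
    For its facet c, the cell [upd c t None] has one more variable, the one not
    chosen by c at t; a value of the boundary collects the cells around c. *)
Definition boundary z : chain :=
  [ffun c : cube => \sum_t face_coef t c * z (upd c t None)].

(** This is meant for starless cubes; the default value at a star is arbitrary. *)
Definition label c : S := \prod_t pair_var t (odflt false (c t)).

Definition augment z : S := \sum_(c : cube | starless c) label c * z c.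

Lemma boundaryE z c : boundary z c = \sum_t face_coef t c * z (upd c t None).
Proof. exact: ffunE. Qed.

Lemma boundaryB z w : boundary (z - w) = boundary z - boundary w.
Proof.
apply/ffunP => c; rewrite boundaryE !ffunE -sumrB.
by apply: eq_bigr => t _; rewrite !ffunE mulrBr.
Qed.

Lemma boundary0 : boundary 0 = 0.
Proof. by have := boundaryB 0 0; rewrite !subrr. Qed.

Lemma boundaryD z w : boundary (z + w) = boundary z + boundary w.
Proof.
by rewrite -{1}[w]opprK boundaryB -[- w]sub0r boundaryB boundary0 sub0r opprK.
Qed.

Lemma augmentB z w : augment (z - w) = augment z - augment w.
Proof. by rewrite -sumrB; apply: eq_bigr => c _; rewrite !ffunE mulrBr. Qed.

Lemma face_coef_star t c : c t = None -> face_coef t c = 0.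
Proof. by move=> ct; rewrite /face_coef ct mulr0. Qed.

(** Starring t moves t into the sign of the later pairs, so the two orders of
    starring two pairs come with opposite signs. *)
Lemma boundary_boundary z : boundary (boundary z) = 0.
Proof.
apply/ffunP => c; rewrite boundaryE [RHS]ffunE.
under eq_bigr => s _ do rewrite boundaryE mulr_sumr.
apply: sum_antisymmetric => [t|s t].
  by rewrite [face_coef t (upd _ _ _)]face_coef_star ?upd_same // mul0r mulr0.
have [->|st] := eqVneq s t.
  by rewrite [face_coef t (upd _ _ _)]face_coef_star ?upd_same // mul0r mulr0 addr0.
have [cs|cs] := eqVneq (c s) None.
  rewrite [face_coef s c]face_coef_star // [face_coef s (upd _ _ _)]face_coef_star.
    by rewrite !mul0r mulr0 addr0.
  by rewrite updE (negbTE st).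
have [ct|ct] := eqVneq (c t) None.
  rewrite [face_coef t c]face_coef_star // [face_coef t (upd _ _ _)]face_coef_star.
    by rewrite !mul0r mulr0 addr0.
  by rewrite updE eq_sym (negbTE st).
rewrite (upd_comm c None None st) /face_coef !updE (negbTE st) [t == s]eq_sym (negbTE st).
rewrite !star_sign_upd // !exprD.
have [_|_|eq_st] := ltngtP (enum_rank s) (enum_rank t); [ring|ring|].
by case/eqP: st; apply/enum_rank_inj/val_inj.
Qed.

Lemma star_sign_starless t c : starless c -> star_sign t c = 0%N.
Proof. by move/eqP=> c0; apply/eqP; rewrite cards_eq0 c0; apply/eqP/setP => s; rewrite !inE. Qed.

Lemma label_upd c t b :
  label (upd c t (Some b)) = pair_var t b * \prod_(s | s != t) pair_var s (odflt false (c s)).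
Proof.
rewrite /label (bigD1 t) //= upd_same; congr (_ * _).
by apply: eq_bigr => s /negbTE st; rewrite updE st.
Qed.

(** Replacing the choice at t by the other one exchanges the two ends of an edge
    of the complex, which have opposite coefficients. *)
Lemma augment_boundary z : augment (boundary z) = 0.
Proof.
rewrite /augment; under eq_bigr => c _ do rewrite boundaryE mulr_sumr.
rewrite exchange_big big1 //= => t _.
pose flip c : cube := upd c t (omap negb (c t)).
have flipK : involutive flip.
  move=> c; rewrite /flip upd_upd upd_same -[RHS](upd_id _ t); congr upd.
  by case: (c t) => [[]|].
have flip_starless c : starless (flip c) = starless c.
  apply/starlessP/starlessP => c0 s; have := c0 s; rewrite updE; case: (s =P t) => [->|//];
  by case: (c t).
rewrite (bigID (fun c : cube => c t == Some true)) /= addrC (reindex_inj (inv_inj flipK)).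
have flip_pred c : starless (flip c) && (flip c t != Some true) =
    starless c && (c t == Some true).
  rewrite flip_starless upd_same; case: starlessP => //= /(_ t).
  by case: (c t) => [[]|].
rewrite (eq_bigl _ _ flip_pred).
rewrite -big_split big1 //= => c /andP[c0 /eqP ct].
rewrite /face_coef !star_sign_starless ?flip_starless // !expr0 !mul1r.
have -> : label c = label (upd c t (Some true)) by rewrite -ct upd_id.
by rewrite upd_upd upd_same ct /flip ct !label_upd /=; ring.
Qed.

End Complex.

Section Exactness.
Variables (n : nat) (K : fieldType) (e : rel 'I_n) (T : finType) (vt : T * bool -> 'I_n).
Hypotheses (e_simple : simple_graph e) (vt_pairing : pairing e vt).
Local Notation S := {mpoly K[n]}.
Local Notation cube := (cube T).
Local Notation chain := {ffun cube -> S}.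
Local Notation pair_var := (@pair_var n K T vt).
Local Notation face_coef := (@face_coef n K T vt).
Local Notation boundary := (@boundary n K T vt).
Local Notation augment := (@augment n K T vt).
Local Notation label := (@label n K T vt).
Local Notation kill_true s := (@kill n K (vt (s, true))).
Implicit Types (s t i j : T) (c : cube) (z w : chain) (D : {set T}) (b : T -> bool).

(** This holds exactly when every choice of vertices in the cube is a vertex
    cover: the edges inside pairs are always covered, and an edge between two
    pairs is covered by all choices only if one of its ends is a fixed choice. *)
Definition admissible c : bool :=
  [forall p, forall q, e (vt p) (vt q) ==> (p.1 != q.1) ==>
     (c p.1 == Some p.2) || (c q.1 == Some q.2)].

Lemma admissibleP c :
  reflect (forall p q, e (vt p) (vt q) -> p.1 != q.1 ->
             c p.1 = Some p.2 \/ c q.1 = Some q.2)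
          (admissible c).
Proof.
apply: (iffP forallP) => [c_adm p q epq pq|c_adm p].
  by have /forallP/(_ q) := c_adm p; rewrite epq pq => /orP[]/eqP; [left|right].
apply/forallP => q; apply/implyP => epq; apply/implyP => pq.
by case: (c_adm p q epq pq) => ->; rewrite eqxx ?orbT.
Qed.

Lemma admissible_face c t o : admissible (upd c t None) -> admissible (upd c t o).
Proof.
move=> /admissibleP c_adm; apply/admissibleP => p q epq pq.
by case: (c_adm p q epq pq); rewrite !updE; case: eqP => // _; [left|right].
Qed.

(** Both choices at s are allowed as soon as the cube contains every vertex
    of another pair that is adjacent to [vt (s, false)]. *)
Lemma admissible_star c s : admissible c -> c s = Some false ->
  (forall i o, i != s -> e (vt (s, false)) (vt (i, o)) -> c i = Some o) ->
  admissible (upd c s None).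
Proof.
have [e_sym _] := e_simple.
move=> /admissibleP c_adm cs nbrs; apply/admissibleP => -[i b] [j b'] /= eij ij.
rewrite !updE; case: (i =P s) ij eij => [->|/eqP is_] ij eij.
  rewrite eq_sym (negbTE ij); right; case: b eij => eij; last by apply: nbrs; rewrite // eq_sym.
  by have [] := c_adm _ _ eij ij; rewrite /= ?cs.
case: (j =P s) ij eij => [->|/eqP js] ij eij; last by have [] := c_adm _ _ eij ij; [left|right].
left; case: b' eij => eij; last by apply: nbrs; rewrite // e_sym.
by have [] := c_adm _ _ eij ij; rewrite /= ?cs.
Qed.

Definition supported (P : pred cube) z : Prop := forall c, ~~ P c -> z c = 0.

(** The order on the pairs that controls the induction: a cover missing the
    vertex [vt (i, true)] contains [vt (j, false)]. *)
Definition pair_le i j : bool := e (vt (i, true)) (vt (j, false)).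

(** The induction fixes the choices pair by pair; D collects the pairs that
    have been dealt with. *)
Definition extends D b : pred cube :=
  fun c => admissible c && [forall t in D, c t == Some (b t)].

Lemma extendsP D b c :
  reflect (admissible c /\ forall t, t \in D -> c t = Some (b t)) (extends D b c).
Proof.
apply: (iffP andP) => -[c_adm cD]; split=> //.
  by move=> t Dt; apply/eqP; move: t Dt; apply/forall_inP.
by apply/forall_inP => t /cD->.
Qed.

Lemma boundary_supported (P Q : pred cube) z :
  (forall c t, c t != None -> P (upd c t None) -> Q c) ->
  supported P z -> supported Q (boundary z).
Proof.
move=> P_face zP c nQc; rewrite boundaryE big1 // => t _.
have [ct|ct] := eqVneq (c t) None; first by rewrite face_coef_star ?mul0r.
by rewrite zP ?mulr0 //; apply: contraNN nQc; apply: P_face.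
Qed.

Lemma extends_face D b c t : extends D b (upd c t None) -> extends D b c.
Proof.
move=> /extendsP[c_adm cD]; apply/extendsP; split.
  by rewrite -(upd_id c t); apply: admissible_face.
by move=> s /cD; rewrite updE; case: eqP.
Qed.

Lemma supportedB (P : pred cube) z w :
  supported P z -> supported P w -> supported P (z - w).
Proof. by move=> zP wP c nPc; rewrite !ffunE zP ?wP ?subrr. Qed.

Lemma supportedW (P Q : pred cube) z :
  (forall c, P c -> Q c) -> supported P z -> supported Q z.
Proof. by move=> PQ zP c nQ; apply: zP; apply: contraNN nQ; apply: PQ. Qed.

Lemma kill_pair_var s t o :
  kill_true s (pair_var t o) = if (t == s) && o then 0 else pair_var t o.
Proof.
rewrite kill_var (bij_eq (pairing_bij vt_pairing)) xpair_eqE.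
by case: o; rewrite ?andbT ?andbF.
Qed.

Lemma kill_face_coef s t c : t != s -> kill_true s (face_coef t c) = face_coef t c.
Proof.
move=> /negbTE ts; rewrite /face_coef rmorphM rmorph_sign; congr (_ * _).
by case: (c t) => [[]|] /=; rewrite ?rmorphN ?rmorph0 /= ?kill_pair_var ?ts.
Qed.

Lemma kill_label s c : kill_true s (label c) = if c s == Some true then 0 else label c.
Proof.
rewrite /label (rmorph_prod (kill_true s)); case: eqP => [cs|/eqP cs].
  by rewrite (bigD1 s) //= kill_pair_var cs eqxx mul0r.
apply: eq_bigr => t _ /=; rewrite kill_pair_var.
by case: (t =P s) cs => [->|//]; case: (c s) => [[]|].
Qed.

Lemma label_neq0 c : label c != 0.
Proof.
apply/prodf_neq0 => t _; apply/negP => /eqP/(congr1 (mcoeff U_(vt (t, odflt false (c t))))).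
by rewrite mcoeffX eqxx mcoeff0 => /eqP; rewrite oner_eq0.
Qed.

(** The cone direction: the cells with value [Some false] at s are extended to
    a star at s, with the sign that makes [boundary_star_lift] hold. *)
Definition star_lift s z : chain :=
  [ffun c : cube => if c s == None then (-1) ^+ star_sign s c * z (upd c s (Some false)) else 0].

Lemma boundary_star_lift s z c : c s = Some false ->
  boundary (star_lift s z) c = pair_var s true * z c.
Proof.
move=> cs; rewrite boundaryE (bigD1 s) //= big1 ?addr0 => [|t ts].
  rewrite [star_lift _ _ _]ffunE upd_same upd_upd -cs upd_id star_sign_self /face_coef cs /=.
  by rewrite mulrACA -expr2 sqrr_sign mul1r. 
by rewrite [star_lift _ _ _]ffunE updE [s == t]eq_sym (negbTE ts) cs mulr0.
Qed.

Hypothesis pair_le_trans : forall i j k, pair_le i j -> pair_le j k -> pair_le i k.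
Hypothesis pair_le_anti : forall i j, pair_le i j -> pair_le j i -> i = j.

Lemma minimal_pair D : D != setT ->
  exists2 s, s \notin D & forall i, pair_le i s -> i != s -> i \in D.
Proof.
move=> DT; have [s0 Ds0] : exists s, s \notin D.
  by apply/existsP; rewrite -negb_forall; apply: contraNN DT => /forallP DT;
     apply/eqP/setP => s; rewrite inE DT.
have [s Ds min_s] := arg_minnP (P := fun s => s \notin D) (fun s => #|[set i | pair_le i s]|) Ds0.
exists s => // i le_is ne_is; apply/negPn/negP => /min_s; apply/negP; rewrite -ltnNge.
apply/proper_card/properP; split.
  by apply/subsetP => j; rewrite !inE => /pair_le_trans; apply.
exists s; first by rewrite inE; apply: (pairing_edge vt_pairing).
by rewrite inE; apply: contraNN ne_is => /(pair_le_anti le_is)->.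
Qed.

Definition exact_on (P : pred cube) : Prop := forall z, supported P z ->
  boundary z = 0 -> augment z = 0 -> exists2 w, supported P w & z = boundary w.

(** The complex is a mapping cone: its cubes starred at s are copies of the
    cubes with value [Some false] at s, and can be moved to [Some true]. Adding a
    boundary makes the values of a cycle at [Some false] free of x_s. The cycle
    condition there is a sum of terms free of x_s and of x_s times the value at
    a starred cube; both parts vanish. So the part at [Some false] is a cycle by
    itself, and once it is removed only the part at [Some true] is left. *)
Lemma exact_on_free D b s : s \notin D ->
  (forall c, extends D b c -> c s = Some false -> extends D b (upd c s None)) ->
  (forall o, exact_on (extends (s |: D) (fun t => if t == s then o else b t))) ->
  exact_on (extends D b).
Proof.
move=> Ds can_star IH z zP dz az.
pose b' o t := if t == s then o else b t.
have ext_sub o c : extends (s |: D) (b' o) c -> extends D b c.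
  move=> /extendsP[c_adm cD]; apply/extendsP; split=> // t Dt.
  rewrite cD ?setU1r // /b'; case: eqP Dt => // ->; by rewrite (negbTE Ds).
have ext_at o c : extends D b c -> c s = Some o -> extends (s |: D) (b' o) c.
  move=> /extendsP[c_adm cD] cs; apply/extendsP; split=> // t; rewrite !inE /b'.
  by case: eqP => [->|_ /cD].
have /fin_all_exists[g g_split] c : exists h : S,
    z c = kill_true s (z c) + pair_var s true * h /\ (z c = 0 -> h = 0).
  have [->|zc] := eqVneq (z c) 0.
    by exists 0; rewrite raddf0 mulr0 addr0.
  by have [h eh] := kill_split (vt (s, true)) (z c); exists h; split=> // /eqP; rewrite (negbTE zc).
pose w1 := star_lift s [ffun c => g c].
have w1P : supported (extends D b) w1.
  move=> c nc; rewrite ffunE; case: eqP => // cs; rewrite ffunE (proj2 (g_split _)) ?mulr0 //.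
  apply: zP; apply: contraNN nc => /can_star; rewrite upd_upd upd_same -cs upd_id.
  exact.
pose z1 := z - boundary w1.
have z1P : supported (extends D b) z1.
  apply: supportedB => //; apply: boundary_supported w1P => c t _; exact: extends_face.
have dz1 : boundary z1 = 0 by rewrite boundaryB dz boundary_boundary subrr.
have az1 : augment z1 = 0 by rewrite augmentB az augment_boundary subrr.
have z1_kill c : c s = Some false -> kill_true s (z1 c) = z1 c.
  move=> cs; have -> : z1 c = kill_true s (z c).
    rewrite !ffunE; have := boundary_star_lift [ffun c => g c] cs; rewrite ffunE => ->.
    by rewrite ffunE {1}(proj1 (g_split c)) addrK.
  exact: kill_idem.
have z1_face c : c s = Some false ->
    z1 (upd c s None) = 0 /\ \sum_(t | t != s) face_coef t c * z1 (upd c t None) = 0.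
  move=> cs; have := congr1 (fun y : chain => y c) dz1.
  rewrite boundaryE ffunE (bigD1 s) //=; set P := \sum_(_ | _) _ => eq0.
  have P0 : P = 0.
    have <- : kill_true s P = P.
      rewrite (raddf_sum (kill_true s)); apply: eq_bigr => t ts.
      by rewrite /= rmorphM /= kill_face_coef // z1_kill // updE [s == t]eq_sym (negbTE ts).
    have -> : P = - (face_coef s c * z1 (upd c s None)) by apply/eqP; rewrite -addr_eq0 addrC eq0.
    rewrite rmorphN rmorphM /face_coef cs rmorphM /= kill_pair_var eqxx.
    by rewrite mulr0 mul0r oppr0.
  split=> //; move/eqP: eq0; rewrite P0 addr0 mulf_eq0 /face_coef cs mulf_eq0 signr_eq0 /=.
  case/orP => [|/eqP//]; move=> /eqP/(congr1 (mcoeff U_(vt (s, true)))).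
  by rewrite mcoeffX eqxx mcoeff0 => /eqP; rewrite oner_eq0.
have z1_star c : c s = None -> z1 c = 0.
  move=> cs; have [|<- _] := z1_face (upd c s (Some false)); first exact: upd_same.
  by rewrite upd_upd -cs upd_id.
pose zy : chain := [ffun c : cube => if c s == Some false then z1 c else 0].
have zyE c : zy c = if c s == Some false then z1 c else 0 by rewrite ffunE.
have [|||w2 w2P zy_w2] := IH false zy.
- move=> c nc; rewrite zyE; case: eqP => // cs; apply: z1P.
  by apply: contraNN nc => /ext_at; apply.
- apply/ffunP => c; rewrite boundaryE [RHS]ffunE; have [cs|cs] := eqVneq (c s) (Some false).
    have [_ P0] := z1_face c cs; rewrite (bigD1 s) //= zyE upd_same mulr0 add0r -[RHS]P0.
    by apply: eq_bigr => t ts; rewrite zyE updE [s == t]eq_sym (negbTE ts) cs eqxx.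
  by rewrite big1 // => t _; rewrite zyE updE; case: (s =P t) => _; rewrite /= ?(negbTE cs) mulr0.
- rewrite -[RHS](raddf0 (kill_true s)) -az1 (raddf_sum (kill_true s)).
  apply: eq_bigr => c /starlessP/(_ s) c0; rewrite /= rmorphM /= kill_label zyE.
  case cs: (c s) c0 => [[]|] // _; first by rewrite mulr0 mul0r.
  by rewrite z1_kill.
pose z2 := z1 - boundary w2.
have [|||w3 w3P z2_w3] := IH true z2.
- move=> c nc; have -> : z2 c = z1 c - zy c by rewrite zy_w2 !ffunE.
  rewrite zyE; case cs: (c s) => [[]|] /=; rewrite ?subr0 ?subrr //.
    by apply: z1P; apply: contraNN nc => /ext_at; apply.
  by rewrite z1_star.
- by rewrite boundaryB dz1 boundary_boundary subrr.
- by rewrite augmentB az1 augment_boundary subrr.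
exists (w1 + w2 + w3).
  move=> c nc; have nc' o : ~~ extends (s |: D) (b' o) c.
    by apply: contraNN nc; apply: ext_sub.
  have -> : (w1 + w2 + w3) c = w1 c + w2 c + w3 c by rewrite !ffunE.
  by rewrite w1P // (w2P _ (nc' _)) (w3P _ (nc' _)) !addr0.
by rewrite !boundaryD -z2_w3 /z2 /z1 -addrA [boundary w2 + _]addrC subrK addrC subrK.
Qed.

(** A pair s minimal outside D has all the other neighbours of y_s in pairs of
    D. If the fixed choices miss one of these neighbours, they force y_s;
    otherwise y_s is only needed for the edge of its own pair. *)
Lemma exact_on_extends D b : (forall i j, pair_le i j -> j \in D -> i \in D) ->
  exact_on (extends D b).
Proof.
have [e_sym _] := e_simple; case: vt_pairing => vt_bij vt_edge vt_indep.
have [k] := ubnP #|~: D|; elim: k D b => // k IHk D b lt_k D_down.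
have [DT|/minimal_pair[s Ds s_min]] := eqVneq D setT.
  move=> z zP _ az; exists 0; first by move=> c _; rewrite ffunE.
  pose cb : cube := [ffun t => Some (b t)].
  have z_other c : c != cb -> z c = 0.
    move=> ccb; apply: zP; apply: contraNN ccb => /extendsP[_ cD].
    by apply/eqP/ffunP => t; rewrite ffunE cD // DT inE.
  rewrite boundary0; apply/ffunP => c; rewrite [RHS]ffunE.
  have [->|/z_other//] := eqVneq c cb.
  have cb0 : starless cb by apply/starlessP => t; rewrite ffunE.
  move/eqP: az; rewrite /augment (bigD1 cb) //= big1 ?addr0 => [|c' /andP[_ /z_other->]].
    by rewrite mulf_eq0 (negbTE (label_neq0 _)) /= => /eqP.
  by rewrite mulr0.
have IH o : exact_on (extends (s |: D) (fun t => if t == s then o else b t)).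
  apply: IHk => [|i j le_ij].
    rewrite -ltnS; apply: leq_trans lt_k; rewrite ltnS; apply/proper_card/properP.
    split; first by rewrite setCS subsetUr.
    by exists s; rewrite !inE ?eqxx.
  rewrite !inE => /orP[/eqP js|Dj]; last by rewrite (D_down i j) ?orbT.
  by have [//|/=] := eqVneq i s; apply: s_min; rewrite -js.
have [/exists_inP[i Di /andP[bi le_is]]|] := boolP [exists i in D, ~~ b i && pair_le i s].
  (* the cover misses [vt (i, true)], which forces [vt (s, false)] *)
  have ext_eq c : extends D b c = extends (s |: D) (fun t => if t == s then false else b t) c.
    have is_ : i != s by apply: contraNneq Ds => <-.
    apply/extendsP/extendsP => -[c_adm cD]; split=> // t.
      rewrite !inE; case: (t =P s) => [-> _|_ /cD //].
      have [|//] := admissibleP _ c_adm _ _ le_is is_.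
      by rewrite /= cD // => -[bi']; rewrite bi' in bi.
    by move=> Dt; rewrite cD ?setU1r //; case: (t =P s) Dt => // ->; rewrite (negbTE Ds).
  move=> z zP dz az; have [|w wP zw] := IH false z _ dz az.
    by apply: supportedW zP => c; rewrite ext_eq.
  by exists w => //; apply: supportedW wP => c; rewrite ext_eq.
rewrite negb_exists_in => /forall_inP all_true.
apply: (exact_on_free Ds _ IH) => c /extendsP[c_adm cD] cs; apply/extendsP; split.
  apply: admissible_star => // i o is_ eis; have o_true : o = true.
    by case: o eis => // eis; case/negP: (vt_indep s i).
  rewrite o_true in eis *; have le_is : pair_le i s by rewrite /pair_le e_sym.
  have Di : i \in D by apply: s_min.
  by have := all_true i Di; rewrite le_is andbT negbK cD // => ->.
by move=> t Dt; rewrite updE; case: (t =P s) Dt => [->|_ /cD//]; rewrite (negbTE Ds).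
Qed.

Lemma exact_on_admissible : exact_on admissible.
Proof.
have ext0 : extends set0 (fun=> true) =1 admissible.
  move=> c; apply/extendsP/idP => [[]//|c_adm]; split=> // t; by rewrite inE.
move=> z zP dz az.
have [||w wP zw] := @exact_on_extends set0 (fun=> true) _ z _ dz az.
- by move=> i j _; rewrite inE.
- by apply: supportedW zP => c; rewrite ext0.
- by exists w => //; apply: supportedW wP => c; rewrite ext0.
Qed.

End Exactness.

(** * The linear resolution of the cover ideal *)

Section Transversals.
Variables (n : nat) (K : fieldType) (e : rel 'I_n) (T : finType) (vt : T * bool -> 'I_n).
Hypotheses (e_simple : simple_graph e) (vt_pairing : pairing e vt).
Local Notation S := {mpoly K[n]}.
Local Notation cube := (cube T).
Implicit Types (c : cube) (m : 'X_{1..n}).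

Definition label_mnm c : 'X_{1..n} := \big[mnm_add/0%MM]_t U_(vt (t, odflt false (c t)))%MM.

Lemma labelE c : label K vt c = 'X_[label_mnm c].
Proof.
apply/esym; apply: (big_morph (fun m : 'X_{1..n} => 'X_[m] : S)) => [m m'|].
  exact: mpolyXD.
exact: mpolyX0.
Qed.

Lemma label_mnmE c p : label_mnm c (vt p) = (odflt false (c p.1) == p.2).
Proof.
rewrite mnm_sumE (bigD1 p.1) //= big1 ?addn0 => [|t tp];
  rewrite mnm1E (bij_eq (pairing_bij vt_pairing)).
  by case: p => t b; rewrite xpair_eqE eqxx.
by case: p tp => s b /= /negbTE; rewrite xpair_eqE => ->.
Qed.

Lemma label_mdeg c : mdeg (label_mnm c) = #|T|.
Proof.
by rewrite mdeg_sum (eq_bigr (fun=> 1%N)) => [|t _]; rewrite ?mdeg1 // sum1_card.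
Qed.

Lemma mdeg_pairs m : mdeg m = (\sum_t (m (vt (t, true)) + m (vt (t, false))))%N.
Proof.
rewrite mdegE (reindex vt) /=; last exact: onW_bij (pairing_bij vt_pairing).
rewrite (eq_bigr (fun p => m (vt (p.1, p.2)))) => [|[] //].
rewrite -(pair_bigA _ (fun t b => m (vt (t, b)))) /=.
by apply: eq_bigr => t _; rewrite big_bool.
Qed.

Lemma vertexP v : exists p, v = vt p.
Proof. by have [vt' _ vtK] := pairing_bij vt_pairing; exists (vt' v). Qed.

Lemma label_in_cover_ideal c : admissible e vt c -> cover_ideal K e (label K vt c).
Proof.
move=> /admissibleP c_adm; apply/mem_cover_ideal => // i j eij m.
rewrite labelE msuppX inE => /eqP->; move: eij.
have [p ->] := vertexP i; have [q ->] := vertexP j => epq.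
rewrite !label_mnmE addn_gt0 !lt0b.
have [pq|/(c_adm _ _ epq)[]->] := eqVneq p.1 q.1; rewrite /= ?eqxx ?orbT //.
have : p != q by apply: contraTneq epq => ->; rewrite (proj2 e_simple).
case: p q pq {epq} => [s b] [t b'] /= <-; rewrite xpair_eqE eqxx /=.
by case: (odflt _ _); case: b; case: b'.
Qed.

Hypothesis e_vwc : very_well_covered e.

Definition cube_of (b : T -> bool) : cube := [ffun t => Some (b t)].

Lemma cube_of_starless b : starless (cube_of b).
Proof. by apply/starlessP => t; rewrite ffunE. Qed.

Lemma cube_of_admissible b : transversal_cover e vt b -> admissible e vt (cube_of b).
Proof.
move=> b_cover; apply/admissibleP => p q epq _; rewrite !ffunE.
by case: (b_cover _ _ epq) => ->; [left|right].
Qed.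

(** The vertices outside the support of a monomial of the cover ideal are
    independent. *)
Lemma label_divides m :
  (forall i j, e i j -> (0 < m i + m j)%N) ->
  exists b, transversal_cover e vt b /\ forall i, (label_mnm (cube_of b) i <= m i)%N.
Proof.
move=> m_cover; have [|b b_cover b_supp] :=
    @transversal_cover_avoiding _ e e_simple e_vwc _ _ vt_pairing [set v | m v == 0%N].
  apply/independentP => u v; rewrite !inE => /eqP mu /eqP mv.
  by apply/negP => /m_cover; rewrite mu mv.
exists b; split=> // i; have [[t o] ->] := vertexP i; rewrite label_mnmE ffunE /=.
by case: eqP => // <-; have := b_supp t; rewrite inE -lt0n.
Qed.

End Transversals.

Section Resolution.
Variables (n : nat) (K : fieldType) (e : rel 'I_n) (T : finType) (vt : T * bool -> 'I_n).
Hypotheses (e_simple : simple_graph e) (e_vwc : very_well_covered e).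
Hypothesis vt_pairing : pairing e vt.
Hypothesis pair_le_anti : forall i j, pair_le e vt i j -> pair_le e vt j i -> i = j.
Local Notation S := {mpoly K[n]}.
Local Notation cube := (cube T).
Local Notation chain := {ffun cube -> S}.
Local Notation boundary := (@boundary n K T vt).
Local Notation augment := (@augment n K T vt).
Local Notation supported := (@supported n K T).
Implicit Types (c : cube) (z w : chain).

Definition cells i : {set cube} := [set c | admissible e vt c & #|stars c| == i].

Definition face_entry c' c : S := \sum_t (c' == upd c t None)%:R * face_coef K vt t c.

Definition cubical_resolution : free_complex n K :=
  @FreeComplex n K (fun i => #|cells i|) (fun i _ => (#|T| + i)%:Z)
    (\col_a label K vt (enum_val a))
    (fun i => \matrix_(a, b) face_entry (enum_val a) (enum_val b)).

Local Notation F := cubical_resolution.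

(** Row vectors over the cells of one dimension correspond to the chains
    supported on these cells. *)
Definition chain_row i z : 'rV[S]_(rank F i) := \row_a z (enum_val a).

Definition on_cells i : pred cube := fun c => c \in cells i.

Lemma chain_row_surj i (u : 'rV_(rank F i)) :
  exists2 z, supported (on_cells i) z & u = chain_row i z.
Proof.
exists [ffun c => \sum_a (enum_val a == c)%:R * u 0 a] => [c nc|].
  rewrite ffunE big1 // => a _; case: eqP => [eq_c|]; last by rewrite mul0r.
  by case/negP: nc; rewrite -eq_c; apply: enum_valP.
apply/rowP => a; rewrite mxE ffunE (bigD1 a) //= eqxx mul1r big1 ?addr0 // => b ba.
by rewrite (inj_eq enum_val_inj) (negbTE ba) mul0r.
Qed.

Lemma chain_row_eq0 i z : supported (on_cells i) z -> chain_row i z = 0 -> z = 0.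
Proof.
move=> zP z0; apply/ffunP => c; rewrite [RHS]ffunE.
have [ci|/zP//] := boolP (c \in cells i).
have := congr1 (fun u : 'rV_ _ => u 0 (enum_rank_in ci c)) z0.
by rewrite !mxE enum_rankK_in.
Qed.

Lemma face_entryE z c : boundary z c = \sum_c' z c' * face_entry c' c.
Proof.
under eq_bigr => c' _ do rewrite mulr_sumr.
rewrite exchange_big boundaryE; apply: eq_bigr => t _ /=.
rewrite (bigD1 (upd c t None)) //= eqxx mul1r big1 ?addr0 1?mulrC // => c' /negbTE->.
by rewrite mul0r mulr0.
Qed.

Lemma chain_row_diff i z : supported (on_cells i.+1) z ->
  chain_row i.+1 z *m diff F i = chain_row i (boundary z).
Proof.
move=> zP; apply/rowP => b; rewrite !mxE face_entryE.
rewrite (bigID (fun c => c \in cells i.+1)) /= [X in _ + X]big1 ?addr0 => [|c /zP->];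
  last by rewrite mul0r.
by rewrite [RHS]big_enum_val; apply: eq_bigr => a _; rewrite !mxE.
Qed.

Lemma cells0 c : (c \in cells 0) = admissible e vt c && starless c.
Proof. by rewrite inE cards_eq0. Qed.

Lemma chain_row_aug z : supported (on_cells 0) z ->
  chain_row 0 z *m aug F = (augment z)%:M.
Proof.
move=> zP; apply/matrixP => i j; rewrite !ord1 [RHS]mxE eqxx mulr1n mxE.
rewrite /augment (bigID (fun c => c \in cells 0)) /= [X in _ + X]big1 ?addr0 => [|c].
  rewrite (eq_bigl (fun c => c \in cells 0)) => [|c];
    last by rewrite cells0; case: starless; rewrite ?andbF.
  by rewrite [RHS]big_enum_val; apply: eq_bigr => a _; rewrite !mxE mulrC.
by case/andP=> _ /zP->; rewrite mulr0.
Qed.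

Lemma card_stars_upd c t : c t != None -> #|stars (upd c t None)| = #|stars c|.+1.
Proof. by move=> ct; rewrite stars_upd cardsU1 inE (negbTE ct). Qed.

Lemma boundary_on_cells i z :
  supported (on_cells i.+1) z -> supported (on_cells i) (boundary z).
Proof.
apply: boundary_supported => c t ct; rewrite /on_cells !inE card_stars_upd // eqSS.
by case/andP=> /(admissible_face (c t)); rewrite upd_id => ->.
Qed.

Lemma boundary_on_vertices z : supported (on_cells 0) z -> boundary z = 0.
Proof.
move=> zP; apply/ffunP => c; rewrite [RHS]ffunE.
apply: (@boundary_supported _ _ _ _ (on_cells 0) pred0 _ _ zP c) => // c' t ct.
by rewrite /on_cells inE card_stars_upd // andbF.
Qed.

Lemma augment_on_cells i z : supported (on_cells i.+1) z -> augment z = 0.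
Proof.
move=> zP; apply: big1 => c c0; rewrite zP ?mulr0 // /on_cells inE.
by rewrite (eqP c0) cards0 andbF.
Qed.

Lemma cubical_exact i z : supported (on_cells i) z -> boundary z = 0 -> augment z = 0 ->
  exists2 w, supported (on_cells i.+1) w & z = boundary w.
Proof.
move=> zP dz az.
have [|w wP zw] := exact_on_admissible e_simple vt_pairing
  (pairing_edge_trans e_simple e_vwc vt_pairing) pair_le_anti _ dz az.
  by apply: supportedW zP => c; rewrite /on_cells inE => /andP[].
pose w' : chain := [ffun c => if c \in cells i.+1 then w c else 0].
have w'P : supported (on_cells i.+1) w'.
  by move=> c nc; rewrite ffunE; case: ifP nc => //; rewrite /on_cells => ->.
exists w' => //; apply/ffunP => c; have [ci|nci] := boolP (c \in cells i); last first.
  by rewrite zP // (boundary_on_cells w'P).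
rewrite zw !boundaryE; apply: eq_bigr => t _.
have [ct|ct] := eqVneq (c t) None; first by rewrite face_coef_star // !mul0r.
rewrite ffunE; case: ifP => // nc; rewrite wP //; apply: contraFN nc => c_adm.
by move: ci; rewrite !inE card_stars_upd // eqSS c_adm => /andP[].
Qed.

Lemma cubical_resolves : resolves (cover_ideal K e) F.
Proof.
have J_ideal : is_ideal (cover_ideal K e).
  split=> [i j eij|f g Jf Jg i j eij|a f Jf i j eij].
  - by case: (ideal_gen_is_ideal (fun g : S => g = 'X_i \/ g = 'X_j)).
  - by case: (ideal_gen_is_ideal (fun g : S => g = 'X_i \/ g = 'X_j)) => _ + _; apply; auto.
  - by case: (ideal_gen_is_ideal (fun g : S => g = 'X_i \/ g = 'X_j)) => _ _; apply; auto.
split=> [f|u|i u].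
- split=> [Jf|[u /matrixP/(_ 0 0)]].
    apply: (@ideal_sum_monomials n K (fun f => exists u : 'rV_(rank F 0), u *m aug F = f%:M)).
      split=> [|g h [u eu] [v ev]|a g [u eu]].
      + by exists 0; rewrite mul0mx raddf0.
      + by exists (u + v); rewrite mulmxDl eu ev raddfD.
      + by exists (a *: u); rewrite -scalemxAl eu scale_scalar_mx.
    move=> m fm; have [|b [b_cover le_bm]] := label_divides e_simple vt_pairing e_vwc (m := m).
      by move=> i j eij; move/mem_cover_ideal: Jf => /(_ _ _ eij); apply.
    pose z : chain := [ffun c => if c == cube_of b then 'X_[m - label_mnm vt (cube_of b)] else 0].
    have z0 : supported (on_cells 0) z.
      move=> c nc; rewrite ffunE; case: eqP nc => // ->.
      by rewrite /on_cells cells0 cube_of_starless cube_of_admissible.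
    exists (chain_row 0 z); rewrite chain_row_aug //; congr (_%:M).
    rewrite /augment (bigD1 (cube_of b)) ?cube_of_starless //= big1 => [|c /andP[_ /negbTE nc]].
      by rewrite addr0 ffunE eqxx labelE mulrC -monomial_divides.
    by rewrite ffunE nc mulr0.
  rewrite [RHS]mxE eqxx mulr1n mxE => <-; case: J_ideal => J0 JD JM.
  elim/big_ind: _ => // a _; rewrite mxE; apply/JM/label_in_cover_ideal => //.
  by have := enum_valP a; rewrite cells0 => /andP[].
- have [z zP ->] := chain_row_surj u; rewrite chain_row_aug //.
  split=> [/matrixP/(_ 0 0)|[v]].
    rewrite !mxE eqxx mulr1n => az.
    have [w wP ->] := cubical_exact zP (boundary_on_vertices zP) az.
    by exists (chain_row 1 w); rewrite chain_row_diff.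
  have [w wP ->] := chain_row_surj v; rewrite chain_row_diff // => zw.
  by rewrite -chain_row_aug // zw chain_row_aug ?augment_boundary ?raddf0 //;
    apply: boundary_on_cells.
have [z zP ->] := chain_row_surj u; rewrite chain_row_diff //; split=> [dz|[v]].
  have [w wP ->] := cubical_exact zP
    (chain_row_eq0 (boundary_on_cells zP) dz) (augment_on_cells zP).
  by exists (chain_row i.+2 w); rewrite chain_row_diff.
have [w wP ->] := chain_row_surj v; rewrite chain_row_diff // => zw.
rewrite -chain_row_diff // zw chain_row_diff; last exact: boundary_on_cells.
by rewrite boundary_boundary; apply/rowP => a; rewrite !mxE ffunE.
Qed.

Lemma face_coef_linear t c : face_coef K vt t c \is 1.-homog.
Proof.
rewrite /face_coef -signr_odd mulr_sign; case: (c t) => [[]|] /=; case: ifP => _;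
  by rewrite ?rpredN ?dhomog0 // dhomogX /= mdeg1.
Qed.

Lemma face_entry_linear c' c : face_entry c' c \is 1.-homog.
Proof.
apply: rpred_sum => t _; case: eqP => _; rewrite ?mul0r ?mul1r ?dhomog0 //.
exact: face_coef_linear.
Qed.

Lemma linear_irrelevant (f : S) : f \is 1.-homog -> irrelevant_ideal f.
Proof.
move/dhomogP=> f1; apply: ideal_sum_monomials; first exact: ideal_gen_is_ideal.
move=> m /f1 /eqP; rewrite mdeg_eq1 => /existsP[i /eqP->].
by apply: mem_ideal_gen; exists i.
Qed.

Lemma cover_ideal_has_linear_resolution : has_linear_resolution (cover_ideal K e).
Proof.
exists F; split; last first.
  exists #|T|%:Z => i t t_neq; apply/eqP; rewrite cards_eq0; apply/eqP/setP => a.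
  rewrite !inE /=; apply: contraNF t_neq => /eqP.
  by rewrite PoszD addrC => /addrI->.
split; [split=> [a|i a b] /=|exact: cubical_resolves|].
- by rewrite mxE labelE dhomogX /= label_mdeg addn0.
- by rewrite mxE addnS -addn1 PoszD addrC addKr; apply: face_entry_linear.
- by move=> i a b; rewrite mxE; apply/linear_irrelevant/face_entry_linear.
Qed.

End Resolution.

(** * What a linear resolution of a symbolic power implies *)

Section Homogeneous.
Variables (n : nat) (K : fieldType).
Local Notation S := {mpoly K[n]}.
Implicit Types (f g h : S) (m : 'X_{1..n}).

Lemma mcoeff_mul_homog d h g m : g \is d.-homog -> mdeg m = d ->
  (h * g)@_m = h@_0%MM * g@_m.
Proof.
move=> /dhomogP g_d m_d.
rewrite -[X in (X * _)@_m](subrK (h@_0%MM)%:MP) mulrDl mcoeffD mcoeffCM.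
suff -> : ((h - (h@_0%MM)%:MP) * g)@_m = 0 by rewrite add0r.
apply: memN_msupp_eq0; apply/negP => /msuppM_le/allpairsP[[m1 m2] [/= h1 /g_d g2 em]].
have m1_0 : m1 = 0%MM.
  apply/eqP; rewrite -mdeg_eq0; move: m_d; rewrite em mdegD g2; lia.
by move: h1; rewrite m1_0 mcoeff_msupp mcoeffB mcoeffC eqxx mulr1 subrr eqxx.
Qed.

(** Only the constant terms of the coefficients matter when an element of
    degree d is expressed by generators of degree d. *)
Lemma homog_combination_constant d r (s : 'I_r -> S) (g : 'I_r -> S) f :
  f \is d.-homog -> (forall a, g a \is d.-homog) -> f = \sum_a s a * g a ->
  f = \sum_a ((s a)@_0%MM)%:MP * g a.
Proof.
move=> f_d g_d ef; apply/mpolyP => m.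
have [m_d|m_d] := eqVneq (mdeg m) d.
  rewrite {1}ef !(raddf_sum (mcoeff m)); apply: eq_bigr => a _ /=.
  by rewrite (mcoeff_mul_homog _ (g_d a)) // mcoeffCM.
rewrite (dhomog_nemf_coeff f_d) // (raddf_sum (mcoeff m)) big1 // => a _ /=.
by rewrite mcoeffCM (dhomog_nemf_coeff (g_d a)) ?mulr0.
Qed.

Lemma linear_shift (F : free_complex n K) (d : int) :
  (forall (i : nat) (t : int), t != d -> betti F i (i%:Z + t) = 0%N) ->
  forall i (a : 'I_(rank F i)), shift a = i%:Z + d.
Proof.
move=> F_lin i a; apply/eqP/negPn/negP => sa.
have ne_d : shift a - i%:Z != d by apply: contraNneq sa => <-; rewrite addrC subrK.
have /eqP := F_lin i _ ne_d; rewrite cards_eq0 => /eqP/setP/(_ a).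
by rewrite !inE addrC subrK eqxx.
Qed.

Lemma resolves_mem (I : S -> Prop) F a : resolves I F -> I (aug F a 0).
Proof.
move=> [IF _ _]; apply/IF; exists (delta_mx 0 a).
by apply/matrixP => i j; rewrite -rowE !ord1 !mxE eqxx mulr1n.
Qed.

Lemma resolves_combination (I : S -> Prop) F f : resolves I F -> I f ->
  exists s : 'I_(rank F 0) -> S, f = \sum_a s a * aug F a 0.
Proof.
move=> [IF _ _] /IF[u /matrixP/(_ 0 0)]; rewrite [RHS]mxE eqxx mulr1n mxE => <-.
by exists (fun a => u 0 a).
Qed.

(** If the generators cannot tell the variables a and b apart when one of them
    is set to 0, then linear syzygies are preserved by setting a to 0 in the
    generators only, because the coefficients satisfy [kill_linear_form]. When
    they generate all syzygies, this substitution extends to an S-linear map on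
    the ideal, which fixes u and annihilates v. By linearity the value at
    [u * v] is v times the value at u, and u times the value at v, which is 0. *)
Lemma linear_syzygies_obstruction d (I : S -> Prop) F (a b : 'I_n) u v :
  resolves I F ->
  (forall r, aug F r 0 \is d.-homog) -> (forall r r', diff F 0 r r' \is 1.-homog) ->
  a != b -> (forall r, kill a (aug F r 0) = kill b (aug F r 0)) ->
  I u -> I v -> u \is d.-homog -> v \is d.-homog ->
  kill a u = u -> kill a v = 0 -> u * v = 0.
Proof.
move=> IF g_d diff1 ab gab Iu Iv u_d v_d ku kv; have [_ syz _] := IF.
pose g r := aug F r 0.
have kill_syz (l : 'I_(rank F 0) -> S) : (forall r, l r \is 1.-homog) ->
    \sum_r l r * g r = 0 -> \sum_r l r * kill a (g r) = 0.
  move=> l1 lg.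
  have ka : \sum_r kill a (l r) * kill a (g r) = 0.
    transitivity (kill a (\sum_r l r * g r)); last by rewrite lg (raddf0 (kill a)).
    rewrite (raddf_sum (kill a)).
    by apply: eq_bigr => r _; rewrite /= rmorphM.
  have kb : \sum_r kill b (l r) * kill a (g r) = 0.
    transitivity (kill b (\sum_r l r * g r)); last by rewrite lg (raddf0 (kill b)).
    rewrite (raddf_sum (kill b)).
    by apply: eq_bigr => r _; rewrite /= rmorphM /= gab.
  have kab : \sum_r kill a (kill b (l r)) * kill a (g r) = 0.
    transitivity (kill a (\sum_r kill b (l r) * kill a (g r)));
      last by rewrite kb (raddf0 (kill a)).
    rewrite (raddf_sum (kill a)).
    by apply: eq_bigr => r _; rewrite /= rmorphM /= kill_idem.
  under eq_bigr => r _ do rewrite (kill_linear_form ab (l1 r)) mulrBl mulrDl.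
  by rewrite sumrB big_split /= ka kb kab addr0 subr0.
have [s us] := resolves_combination IF Iu; have [t vt] := resolves_combination IF Iv.
have {}us := homog_combination_constant u_d g_d us.
have {}vt := homog_combination_constant v_d g_d vt.
pose s0 r : S := ((s r)@_0%MM)%:MP; pose t0 r : S := ((t r)@_0%MM)%:MP.
have kC c : kill a (c%:MP : S) = c%:MP by exact: mmapC.
have us' : \sum_r s0 r * kill a (g r) = u.
  rewrite -[RHS]ku us (raddf_sum (kill a)).
  by apply: eq_bigr => r _; rewrite /= rmorphM /= kC.
have vt' : \sum_r t0 r * kill a (g r) = 0.
  rewrite -[RHS]kv {1}vt (raddf_sum (kill a)).
  by apply: eq_bigr => r _; rewrite /= rmorphM /= kC.
have [|y wy] := proj1 (syz (\row_r (v * s0 r - u * t0 r))).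
  apply/matrixP => i j; rewrite !ord1 !mxE.
  under eq_bigr => r _ do rewrite mxE mulrBl -!mulrA.
  by rewrite sumrB -!mulr_sumr -us -vt mulrC subrr.
have : \sum_r (v * s0 r - u * t0 r) * kill a (g r) = 0.
  transitivity (\sum_r' y 0 r' * \sum_r diff F 0 r' r * kill a (g r)).
    under [RHS]eq_bigr => r' _ do rewrite mulr_sumr.
    rewrite exchange_big; apply: eq_bigr => r _ /=.
    have /matrixP/(_ 0 r) := wy; rewrite mxE => ->; rewrite mxE mulr_suml.
    by apply: eq_bigr => r' _; rewrite mulrA.
  apply: big1 => r' _; rewrite kill_syz ?mulr0 //.
  have [_ /(_ (ex_intro _ (delta_mx 0 r') erefl))] := syz (delta_mx 0 r' *m diff F 0).
  rewrite -rowE => /matrixP/(_ 0 0); rewrite !mxE => {2}<-.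
  by apply: eq_bigr => r _; rewrite mxE.
under eq_bigr => r _ do rewrite mulrBl -!mulrA.
by rewrite sumrB -!mulr_sumr us' vt' mulr0 subr0 mulrC.
Qed.

End Homogeneous.

Section Symbolic.
Variables (n : nat) (K : fieldType) (e : rel 'I_n) (T : finType) (vt : T * bool -> 'I_n).
Hypotheses (e_simple : simple_graph e) (e_vwc : very_well_covered e).
Hypothesis vt_pairing : pairing e vt.
Local Notation S := {mpoly K[n]}.
Variable k : nat.
Hypothesis k_gt0 : (0 < k)%N.
Local Notation I := (symbolic_pow (cover_ideal K e) k).
Implicit Types (i j : T) (m : 'X_{1..n}).

Lemma mdeg_symbolic m :
  (forall u v, e u v -> (k <= m u + m v)%N) -> (k * #|T| <= mdeg m)%N.
Proof.
move=> m_ge; rewrite (mdeg_pairs vt_pairing) mulnC -sum_nat_const.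
by apply: leq_sum => t _; apply/m_ge/(pairing_edge vt_pairing).
Qed.

(** In the lowest degree the exponents of each pair add up to k, so two crossing
    edges leave no freedom between the pairs i and j. *)
Lemma symbolic_exponents_eq m i j :
  (forall u v, e u v -> (k <= m u + m v)%N) -> mdeg m = (k * #|T|)%N ->
  pair_le e vt i j -> pair_le e vt j i -> m (vt (i, true)) = m (vt (j, true)).
Proof.
move=> m_ge m_deg /m_ge ij /m_ge ji.
have pair_sum t : (m (vt (t, true)) + m (vt (t, false)) <= k)%N.
  have : (\sum_(s | s != t) k <= \sum_(s | s != t) (m (vt (s, true)) + m (vt (s, false))))%N.
    by apply: leq_sum => s _; apply/m_ge/(pairing_edge vt_pairing).
  have : (\sum_(s : T) k = \sum_s (m (vt (s, true)) + m (vt (s, false))))%N.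
    by rewrite -(mdeg_pairs vt_pairing) m_deg sum_nat_const mulnC.
  by rewrite (bigD1 t) //= [in RHS](bigD1 t) //=; lia.
have := pair_sum i; have := pair_sum j; lia.
Qed.

Definition cover_power (b : T -> bool) : S := label K vt (cube_of b) ^+ k.

Lemma cover_power_mem b : transversal_cover e vt b -> I (cover_power b).
Proof.
by move=> b_cover; apply/expr_symbolic_pow/label_in_cover_ideal => //;
  apply: cube_of_admissible.
Qed.

Lemma cover_powerE b : cover_power b = 'X_[label_mnm vt (cube_of b) *+ k].
Proof. by rewrite /cover_power labelE mpolyXn. Qed.

Lemma cover_power_homog b : cover_power b \is (k * #|T|).-homog.
Proof. by rewrite cover_powerE dhomogX /= mdegMn label_mdeg mulnC. Qed.

Lemma kill_cover_power b i :
  kill (vt (i, true)) (cover_power b) = if b i then 0 else cover_power b.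
Proof.
rewrite cover_powerE killX mulmnE (label_mnmE vt_pairing) ffunE /= muln_eq0.
by rewrite (gtn_eqF k_gt0) orbF; case: (b i).
Qed.

(** No element of the symbolic power has a monomial of smaller degree, and the
    power of a cover with one vertex in each pair has this degree. *)
Lemma generator_degree F (d : int) : resolves I F ->
  (forall r, homog_of_degree d (aug F r 0)) ->
  d = (k * #|T|)%:Z.
Proof.
move=> IF aug_d.
have [|b b_cover _] := @transversal_cover_avoiding _ e e_simple e_vwc _ _ vt_pairing set0.
  by apply/independentP => u v; rewrite inE.
have [s es] := resolves_combination IF (cover_power_mem b_cover).
set m := (label_mnm vt (cube_of b) *+ k)%MM.
have m_deg : mdeg m = (k * #|T|)%N by rewrite mdegMn label_mdeg mulnC.
have [r sr] : exists r, m \in msupp (s r * aug F r 0).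
  apply/existsP; rewrite -[X in is_true X]negbK negb_exists; apply/negP => /forallP sN.
  have /eqP := congr1 (mcoeff m) es; rewrite cover_powerE mcoeffX eqxx.
  rewrite (raddf_sum (mcoeff m)) big1 ?oner_eq0 // => r _ /=.
  exact/memN_msupp_eq0/sN.
have /msuppM_le/allpairsP[[m1 m2] [/= _ g2 em]] := sr.
have := mdeg_symbolic (fun u v euv =>
  symbolic_pow_monomials e_simple (resolves_mem r IF) euv g2).
have := aug_d r; case: d {aug_d} => [d|d] /=; last by move=> g0; move: g2; rewrite g0 msupp0.
move=> /dhomogP/(_ _ g2)/= d2; move: m_deg; rewrite em mdegD d2 => m_deg ge_d.
by congr Posz; apply/eqP; rewrite eqn_leq ge_d -m_deg leq_addl.
Qed.

(** The obstruction applies to the powers of two covers. The first omits x_i;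
    the second contains x_i because it omits y_i. *)
Lemma pair_le_anti_of_linear_resolution :
  has_linear_resolution I ->
  forall i j, pair_le e vt i j -> pair_le e vt j i -> i = j.
Proof.
move=> [F [[[aug_d diff_d] IF _] [d F_lin]]] i j ij ji; apply/eqP/negPn/negP => ne_ij.
have sh := linear_shift F_lin.
have ed : d = (k * #|T|)%:Z.
  by apply: (generator_degree IF) => r; have := aug_d r; rewrite sh add0r.
have g_d r : aug F r 0 \is (k * #|T|).-homog.
  by have := aug_d r; rewrite sh add0r ed.
have [|b b_cover b_avoid] :=
    @transversal_cover_avoiding _ e e_simple e_vwc _ _ vt_pairing [set vt (i, true)].
  exact: independent1.
have bi : b i = false.
  by apply/negP => bi; have := b_avoid i; rewrite bi inE eqxx.
have [|c c_cover c_avoid] :=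
    @transversal_cover_avoiding _ e e_simple e_vwc _ _ vt_pairing [set vt (i, false)].
  exact: independent1.
have ci : c i = true.
  by apply/negPn/negP => /negbTE ci; have := c_avoid i; rewrite ci inE eqxx.
have := @linear_syzygies_obstruction _ _ (k * #|T|) I F (vt (i, true)) (vt (j, true))
  (cover_power b) (cover_power c) IF g_d.
rewrite !kill_cover_power bi ci => /(_ _ _ _ (cover_power_mem b_cover) (cover_power_mem c_cover)
   (cover_power_homog b) (cover_power_homog c) erefl erefl) uv0.
have /eqP[] : cover_power b * cover_power c != 0.
  by rewrite mulf_neq0 // expf_neq0 // label_neq0.
apply: uv0 => [r r'||r].
- have := diff_d 0%N r r'; rewrite !sh.
  by have -> : 1%:Z + d - (0%:Z + d) = 1 by lia.
- by rewrite (bij_eq (pairing_bij vt_pairing)) xpair_eqE andbT.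
apply/mpolyP => m; rewrite !kill_coef.
have [gm|/memN_msupp_eq0->] := boolP (m \in msupp (aug F r 0)); last by rewrite !if_same.
rewrite (@symbolic_exponents_eq m i j) //; last exact: (dhomogP _ _ _ (g_d r)).
by move=> u v euv; apply: (symbolic_pow_monomials e_simple (resolves_mem r IF)).
Qed.

End Symbolic.

Theorem proposition3p1 (K : fieldType) (n : nat) (e : rel 'I_n)
  (he : simple_graph e) (hvwc : very_well_covered e) (k : nat) (hk : (1 <= k)%N)
  (hlin : has_linear_resolution (symbolic_pow (cover_ideal K e) k)) :
  has_linear_resolution (cover_ideal K e).
Proof.
have [T [vt vt_pairing]] := pairing_exists he hvwc.
exact: cover_ideal_has_linear_resolution he hvwc vt_pairing
  (pair_le_anti_of_linear_resolution he hvwc vt_pairing hk hlin).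
Qed.
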